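(* Let $f$ be a bounded $C^\infty$ function on $\mathbb{R}^d$ and put $F(z)=f(|z_1|^2,\dots,|z_d|^2)$ for $z\in\mathbb{C}^d$. Then for every positive integer $N$ and every $k\in N\Delta\cap\mathbb{Z}^d$, $$\frac{1}{c_{N,k}^2}\int_{\mathbb{C}^d}|z^k|^2e^{-N|z|^2}F(z)\,dz\,d\bar z=(A_Nf)\left(\frac kN\right),$$ and consequently, as $N\to\infty$ with $k\in N\Delta\cap\mathbb{Z}^d$, this integral has the asymptotic expansion $$\frac{1}{c_{N,k}^2}\int_{\mathbb{C}^d}|z^k|^2e^{-N|z|^2}F(z)\,dz\,d\bar z\;\sim\;\sum_{\alpha\in\mathbb{Z}_{\ge0}^d}N^{-|\alpha|}\,f^{(\alpha)}\left(\frac kN\right)g_\alpha(k),$$ in which the $\alpha$-th summand is of order $O(N^{-|\alpha|/2})$. That is, for every integer $M\ge1$ there is a constant $C$ such that for all $N\ge1$ and all $k\in N\Delta\cap\mathbb{Z}^d$ the difference between the left-hand side and the sum of the terms with $|\alpha|<M$ is at most $CN^{-M/2}$ in absolute value.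
   Context: $dz\,d\bar z$ denotes Lebesgue measure on $\mathbb{C}^d=\mathbb{R}^{2d}$, $z^k=z_1^{k_1}\cdots z_d^{k_d}$, $|z|^2=\sum_i|z_i|^2$, and $c_{N,k}=\left(\int_{\mathbb{C}^d}|z^k|^2e^{-N|z|^2}\,dz\,d\bar z\right)^{1/2}$. The polytope $\Delta$: let $G$ be a subtorus of $T^d=(S^1)^d$ with Lie algebra $\mathfrak g\subset\mathbb{R}^d$, let $L:(\mathbb{R}^d)^*\to\mathfrak g^*$ be the dual of the inclusion, $e_1^*,\dots,e_d^*$ the standard dual basis, and $\alpha_i=Le_i^*$ the weights of the action of $G$ on $\mathbb{C}^d$. Let $\lambda\in\mathbb{Z}_G^*$ be a weight of $G$ such that the reduction of $\mathbb{C}^d$ by $G$ at $\lambda$ is a compact toric (Kähler) manifold. Then $\Delta=\{x\in\mathbb{R}^d:\ x_i\ge0,\ \sum_i x_i\alpha_i=\lambda\}$, a compact convex polytope, and $N\Delta=\{Nx:x\in\Delta\}$. The $N$-twisted Mellin transform of a bounded $C^\infty$ function $f$ on $\mathbb{R}^d$ is, for $x\in\mathbb{R}^d$ with all $x_i\ge0$, $$A_Nf(x)=\frac{\int_{\mathbb{R}^d_+}e^{N\sum_i(x_i\log y_i-y_i)}f(y)\,dy}{\int_{\mathbb{R}^d_+}e^{N\sum_i(x_i\log y_i-y_i)}\,dy}.$$ For a multi-index $\alpha=(\alpha_1,\dots,\alpha_d)\in\mathbb{Z}_{\ge0}^d$ (not to be confused with the weights $\alpha_i$ above), $|\alpha|=\sum_i\alpha_i$,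 $f^{(\alpha)}=\partial^\alpha f$, and $g_\alpha(x)=g_{\alpha_1}(x_1)\cdots g_{\alpha_d}(x_d)$, where for an integer $m\ge0$ $$g_m(s)=\frac1{m!}\sum_{0\le\ell\le m}(-1)^\ell\binom m\ell s^\ell s^{(m-\ell)},\qquad s^{(j)}=(s+j)(s+j-1)\cdots(s+1),\quad s^{(0)}=1.$$ *)

(* Defs.v *)
From HB Require Import structures.
From mathcomp Require Import all_boot all_order all_algebra.
From mathcomp Require Import complex.
From mathcomp Require Import all_classical all_reals all_analysis.

Set Implicit Arguments.
Unset Strict Implicit.
Unset Printing Implicit Defensive.
Import Order.TTheory GRing.Theory Num.Theory.
Import numFieldNormedType.Exports.
Import Normc.

Local Open Scope classical_set_scope.
Local Open Scope complex_scope.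
Local Open Scope ring_scope.

(* Lebesgue measure on R^n, realised on n.-tuple R with the product of the
   Borel sigma-algebras, as the iterated product of [lebesgue_measure]. *)

Section lebesgue_tuple.
Context {R : realType}.
Local Notation mR := (measurableTypeR R).

Definition tcons n (p : mR * n.-tuple mR) : n.+1.-tuple mR :=
  [tuple of p.1 :: p.2].

Lemma measurable_tcons n : measurable_fun [set: mR * n.-tuple mR] (@tcons n).
Proof. exact: (measurable_cons measurable_fst measurable_snd). Qed.

Section step.
Variables (n : nat) (mu : {sigma_finite_measure set (n.-tuple mR) -> \bar R}).
Local Open Scope ereal_scope.

Definition leb_step : set (n.+1.-tuple mR) -> \bar R :=
  pushforward (lebesgue_measure \x mu) (@tcons n).

Let leb_step0 : leb_step set0 = 0.
Proof. by rewrite /leb_step /pushforward preimage_set0; exact: (measure0 (lebesgue_measure \x mu)). Qed.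

Let leb_step_ge0 A : 0 <= leb_step A.
Proof. exact: (measure_ge0 (lebesgue_measure \x mu)%E). Qed.

Let leb_step_sigma_additive : semi_sigma_additive leb_step.
Proof.
move=> F mF tF mUF; rewrite /leb_step /pushforward preimage_bigcup.
have mpre A : measurable A -> measurable (@tcons n @^-1` A).
  by move=> mA; rewrite -[X in measurable X]setTI; exact: measurable_tcons.
apply: measure_semi_sigma_additive.
- by move=> i; exact: mpre.
- apply/trivIsetP => /= i j _ _ ij; rewrite -preimage_setI.
  by move/trivIsetP : tF => /(_ _ _ _ _ ij) ->//; rewrite preimage_set0.
- by rewrite -preimage_bigcup; exact: mpre.
Qed.

HB.instance Definition _ := isMeasure.Build _ _ _ leb_step
  leb_step0 leb_step_ge0 leb_step_sigma_additive.

Let leb_step_sigma_finite : sigma_finite setT leb_step.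
Proof.
have /sigma_finiteP[F [TF ndF Foo]] := sigma_finiteT (@lebesgue_measure R).
have /sigma_finiteP[H [TH ndH Hoo]] := sigma_finiteT mu.
pose split_tuple (t : n.+1.-tuple mR) := (thead t, [tuple of behead t]).
have msplit : measurable_fun setT split_tuple.
  apply/measurable_fun_pairP; split => /=.
    exact: (measurable_tnth ord0).
  exact: measurable_behead.
have tconsK : split_tuple \o (@tcons n) = id.
  apply/funext => -[x t]; rewrite /split_tuple /tcons /= theadE.
  by congr pair; exact: val_inj.
exists (fun k => split_tuple @^-1` (F k `*` H k)).
  rewrite -preimage_bigcup (_ : \bigcup_k _ = setT) ?preimage_setT//.
  rewrite -subTset => -[x y] _.
  have [k _ Fkx] : (\bigcup_k F k) x by rewrite -TF.
  have [l _ Hly] : (\bigcup_k H k) y by rewrite -TH.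
  exists (maxn k l) => //; split => /=.
    by move: x Fkx; exact/subsetPset/ndF/leq_maxl.
  by move: y Hly; exact/subsetPset/ndH/leq_maxr.
move=> k; have [mFk Fkoo] := Foo k; have [mHk Hkoo] := Hoo k; split.
  by rewrite -[X in measurable X]setTI; apply: msplit => //; exact: measurableX.
rewrite /leb_step /pushforward -comp_preimage tconsK preimage_id.
by rewrite product_measure1E// lte_mul_pinfty// ge0_fin_numE.
Qed.

HB.instance Definition _ :=
  Measure_isSigmaFinite.Build _ _ _ leb_step leb_step_sigma_finite.

End step.

Fixpoint leb n : {sigma_finite_measure set (n.-tuple mR) -> \bar R} :=
  match n with
  | 0 => \d_([tuple] : 0.-tuple mR)
  | n'.+1 => leb_step (leb n')
  end.

End lebesgue_tuple.

Section integrals.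
Context {R : realType} (d : nat).

Definition vec_of_tuple (t : d.-tuple (measurableTypeR R)) : 'rV[R]_d :=
  \row_i tnth t i.

(* C^d = R^{2d} via z_j = t_j + i t_{d+j}; the topology of 'rV[R[i]^o]_d is
   the usual one of C^d. *)
Definition cvec_of_tuple (t : (d + d).-tuple (measurableTypeR R)) :
    'rV[R[i]^o]_d :=
  \row_j (tnth t (lshift d j) +i* tnth t (rshift d j)).

Definition integral_Rd (D : set 'rV[R]_d) (h : 'rV[R]_d -> R) : R :=
  \int[leb d]_(t in vec_of_tuple @^-1` D) h (vec_of_tuple t).

Definition integral_Cd (h : 'rV[R[i]^o]_d -> R) : R :=
  \int[leb (d + d)]_t h (cvec_of_tuple t).

End integrals.

Section torus_reduction.
Context {R : realType} (d : nat).
Local Notation Cd := 'rV[R[i]^o]_d.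
Implicit Types (G : set Cd) (z u v : Cd).

(* T^d acts on C^d by componentwise multiplication, which is also the group
   law of T^d; its unit is the all-ones vector. *)
Definition cmul u z : Cd := \row_j (u 0 j * z 0 j).

Definition torus : set Cd := [set u | forall j, normc (u 0 j) = 1].

Definition is_subtorus G : Prop :=
  [/\ G `<=` torus,
      G (const_mx 1) /\ (forall u v, G u -> G v -> G (cmul u v)),
      forall u, G u -> G (\row_j (u 0 j)^-1) &
      closed G /\ connected G].

(* exp : R^d -> T^d, normalised so that its kernel is Z^d. *)
Definition torus_exp (v : 'rV[R]_d) : Cd :=
  \row_j (cos (2 * pi * v 0 j) +i* sin (2 * pi * v 0 j)).

Definition is_lie_algebra G (g : {vspace 'rV[R]_d}) : Prop :=
  forall v : 'rV[R]_d, v \in g <-> (forall t : R, G (torus_exp (t *: v))).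

Section weights.
Variable g : {vspace 'rV[R]_d}.
Local Notation dual_g := 'Hom(subvs_of g, R^o).

(* L : (R^d)^* -> g^*, the transpose of the inclusion. *)
Definition dual_incl (phi : 'Hom('rV[R]_d, R^o)) : dual_g :=
  (phi \o linfun (vsval : subvs_of g -> 'rV[R]_d))%VF.

Definition dual_basis (j : 'I_d) : 'Hom('rV[R]_d, R^o) :=
  linfun (fun v : 'rV[R]_d => v 0 j : R^o).

Definition weight (j : 'I_d) : dual_g := dual_incl (dual_basis j).

(* Z_G^*, the dual of the integral lattice ker (exp : g -> G). *)
Definition weight_lattice : set dual_g :=
  [set l | forall v : subvs_of g,
     torus_exp (vsval v) = const_mx 1 -> l v \is a Num.int].

Definition moment_map (z : Cd) : dual_g :=
  \sum_j (normc (z 0 j) ^+ 2) *: weight j.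

Definition level_set (l : dual_g) : set Cd := moment_map @^-1` [set l].

Definition polytope (l : dual_g) : set 'rV[R]_d :=
  [set x | (forall j, 0 <= x 0 j) /\ \sum_j x 0 j *: weight j = l].

End weights.

(* The reduced space Phi^-1(l) / G, with the quotient topology.  Two points
   are identified when their G-orbits coincide. *)
Section quotient.
Variables (G : set Cd) (A : set Cd).

Definition same_orbit (z w : A) : bool :=
  `[< [set cmul u (val z) | u in G] = [set cmul u (val w) | u in G] >].

Lemma same_orbit_refl : reflexive same_orbit.
Proof. by move=> z; apply/asboolP. Qed.

Lemma same_orbit_sym : symmetric same_orbit.
Proof. by move=> z w; apply/asboolP/asboolP => ->. Qed.

Lemma same_orbit_trans : transitive same_orbit.
Proof. by move=> z w t /asboolP wz /asboolP zt; apply/asboolP; rewrite wz. Qed.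

Canonical same_orbit_equiv :=
  EquivRel same_orbit same_orbit_refl same_orbit_sym same_orbit_trans.

Definition orbit_space : topologicalType :=
  quotient_topology {eq_quot same_orbit_equiv}%qT.

End quotient.

(* Symplectic reduction is a manifold when G acts freely on the level set;
   freeness makes l a regular value of the moment map, and the smooth, Kaehler
   and toric structures on the quotient are then automatic. *)
Definition compact_toric_reduction G (g : {vspace 'rV[R]_d})
    (l : 'Hom(subvs_of g, R^o)) : Prop :=
  (forall u z, G u -> level_set l z -> cmul u z = z -> u = const_mx 1) /\
  compact [set: orbit_space G (level_set l)].

End torus_reduction.

Section smooth_functions.
Context {R : realType} (d : nat).
Implicit Types (f : 'rV[R]_d -> R).

Definition partial (j : 'I_d) f : 'rV[R]_d -> R :=
  fun x => 'D_(delta_mx 0 j) f x.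

Definition partials (s : seq 'I_d) f : 'rV[R]_d -> R := foldr partial f s.

Definition smooth f : Prop := forall s : seq 'I_d,
  continuous (partials s f) /\
  forall j x, derivable (partials s f) x (delta_mx 0 j).

Definition multi_partial (alpha : 'I_d -> nat) f : 'rV[R]_d -> R :=
  foldr (fun j => iter (alpha j) (partial j)) f (enum 'I_d).

End smooth_functions.

Section mellin.
Context {R : realType} (d : nat).
Local Notation Cd := 'rV[R[i]^o]_d.

Definition positive_orthant : set 'rV[R]_d := [set y | forall j, 0 < y 0 j].

Definition mellin_weight (N : nat) (x y : 'rV[R]_d) : R :=
  expR (N%:R * \sum_j (x 0 j * ln (y 0 j) - y 0 j)).

Definition twisted_mellin (N : nat) (f : 'rV[R]_d -> R) (x : 'rV[R]_d) : R :=
  integral_Rd positive_orthant (fun y => mellin_weight N x y * f y) /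
  integral_Rd positive_orthant (mellin_weight N x).

Definition monomial (k : 'rV[int]_d) (z : Cd) : R[i] :=
  \prod_j (z 0 j : R[i]) ^ k 0 j.

Definition gauss_weight (N : nat) (k : 'rV[int]_d) (z : Cd) : R :=
  normc (monomial k z) ^+ 2 * expR (- (N%:R * \sum_j normc (z 0 j) ^+ 2)).

Definition cNk (N : nat) (k : 'rV[int]_d) : R :=
  Num.sqrt (integral_Cd (gauss_weight N k)).

Definition lift_moduli (f : 'rV[R]_d -> R) (z : Cd) : R :=
  f (\row_j normc (z 0 j) ^+ 2).

Definition normalized_integral (N : nat) (k : 'rV[int]_d) (F : Cd -> R) : R :=
  (cNk N k ^+ 2)^-1 * integral_Cd (fun z => gauss_weight N k z * F z).

Definition rising (s : R) (j : nat) : R := \prod_(i < j) (s + i.+1%:R).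

Definition g1 (m : nat) (s : R) : R :=
  (m`!%:R)^-1 *
  \sum_(l < m.+1) (-1) ^+ l * 'C(m, l)%:R * s ^+ l * rising s (m - l).

Definition g_multi (alpha : 'I_d -> nat) (x : 'rV[R]_d) : R :=
  \prod_j g1 (alpha j) (x 0 j).

Definition real_point (k : 'rV[int]_d) : 'rV[R]_d := map_mx intr k.

Definition expansion_term (f : 'rV[R]_d -> R) (N : nat) (k : 'rV[int]_d)
    (alpha : 'I_d -> nat) : R :=
  N%:R ^- (\sum_j alpha j)%N *
  multi_partial alpha f (N%:R^-1 *: real_point k) *
  g_multi alpha (real_point k).

(* Multi-indices with |alpha| < M have all entries below M, so they are
   enumerated by a filter on the finite type {ffun 'I_d -> 'I_M}. *)
Definition expansion_sum (f : 'rV[R]_d -> R) (N : nat) (k : 'rV[int]_d)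
    (M : nat) : R :=
  \sum_(alpha : {ffun 'I_d -> 'I_M} | (\sum_j alpha j < M)%N)
    expansion_term f N k (fun j => alpha j).

(* k \in N Delta \cap Z^d, with N Delta = {N x : x \in Delta}. *)
Definition lattice_point (Delta : set 'rV[R]_d) (N : nat) (k : 'rV[int]_d)
    : Prop :=
  [set N%:R *: x | x in Delta] (real_point k).

End mellin.

(* Main.v *)
Require Import Defs.
From mathcomp Require Import all_boot all_order all_algebra.
From mathcomp Require Import complex.
From mathcomp Require Import all_classical all_reals all_analysis.
From mathcomp Require Import measurable_realfun zify ring lra.
Set Implicit Arguments.
Unset Strict Implicit.
Unset Printing Implicit Defensive.
Import Order.TTheory GRing.Theory Num.Theory.
Import numFieldNormedType.Exports.
Local Open Scope classical_set_scope.
Local Open Scope complex_scope.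
Local Open Scope ring_scope.
Import Normc.

(** Polar coordinates turn Lebesgue measure on each factor of C^d into a constant
    multiple of d(|z_j|^2), so the image of Lebesgue measure on C^d by
    z |-> (|z_1|^2, ..., |z_d|^2) is a constant multiple of Lebesgue measure on the
    positive orthant ([radial_integral]).  At y_j = |z_j|^2 the weight
    |z^k|^2 e^(-N |z|^2) is the product of the y_j^(k_j) e^(- N y_j), which is also
    the Mellin weight at x = k / N.  The polar constant cancels in the normalised
    integral, and both sides of the first claim are the expectation of f(Y), where
    the Y_j are independent gamma variables of shape k_j + 1 and rate N
    ([normalized_integralE], [twisted_mellinE]).

    For this law E (Y_j - x_j)^m = N^(-m) m! g_m(k_j) ([gamma_momentE],
    [gamma_expect_centered]), so the expectation of the Taylor polynomial of f at x
    is exactly the asserted series ([gamma_expect_taylor_cube]).  Integration by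
    parts yields the recurrence mu_(m+1) = (m + 1) mu_m + m s mu_(m-1) for the
    centered moments mu_m(s) = m! g_m(s), and hence mu_m(s) = O((s + 1)^(m / 2))
    ([gamma_moment_bound]).  Compactness of the reduced space makes the polytope
    bounded ([polytope_bounded]), so that k_j = O(N) and N^(-m) mu_m(k_j) is
    O(N^(- m / 2)) uniformly in k.  This gives the size of each term
    ([expansion_term_bound]) and of the expected Taylor remainder
    ([taylor_expect_bound]).

    Only f itself is bounded on all of R^d, not its derivatives.  The Taylor remainder is
    therefore estimated by compactness near x, and by the bound on f far from x,
    where a high power of |y - x| dominates everything ([taylor_global]).  The Taylor
    polynomial is built one coordinate at a time and runs over the cube of
    multi-indices with all entries below M; its terms with |alpha| >= M are
    O(N^(- M / 2)) and can be dropped. *)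

(** * Boundedness of the polytope *)

Section polytope_bounded.
Context {R : realType} (d : nat).
Local Notation Cd := 'rV[R[i]^o]_d.

Lemma normc_sqr (x y : R) : normc (x +i* y) ^+ 2 = x ^+ 2 + y ^+ 2.
Proof. by rewrite /normc sqr_sqrtr// addr_ge0// sqr_ge0. Qed.

Lemma ler_distB_normc (z w : R[i]) : `|normc z - normc w| <= normc (z - w).
Proof.
have h (u v : R[i]) : normc u - normc v <= normc (u - v).
  by rewrite lerBlDr (le_trans _ (le_normcD _ _))// subrK.
by rewrite ler_norml h andbT lerNl opprB (le_trans (h w z))// -normcN opprB.
Qed.

Lemma continuous_normc : continuous (fun z : R[i]^o => normc z : R).
Proof.
move=> z B /= /(nbhs_ballP (normc z : R)) [e e0 eB].
apply/nbhs_ballP; exists e%:C; first by rewrite /= ltcR.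
move=> w; rewrite /ball /= => zw; apply: eB; rewrite /ball /=.
by rewrite (le_lt_trans (ler_distB_normc _ _))// -ltcR.
Qed.

(** The moduli |z_j| are invariant under the torus, hence define continuous
    functions on the compact reduced space and are bounded on the level set.  Every
    point x of the polytope is the vector of squared moduli of the point
    (sqrt x_1, ..., sqrt x_d) of the level set. *)
Lemma polytope_bounded (G : set Cd) (g : {vspace 'rV[R]_d})
    (l : 'Hom(subvs_of g, R^o)) : G `<=` torus (d := d) -> G (const_mx 1) ->
  compact [set: orbit_space G (level_set l)] ->
  exists K : R, forall x, polytope l x -> forall j, 0 <= x 0 j <= K.
Proof.
move=> Gtorus G1 cQ.
pose A := level_set l.
pose F (j : 'I_d) (z : A) : R := normc (val z 0 j).
have cF j : continuous (F j).
  move=> z.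
  apply: (@continuous_comp _ _ _ (fun z : A => val z 0 j) (fun c : R[i]^o => normc c : R)).
    apply: (@continuous_comp _ _ _ (val : A -> Cd) (fun M : Cd => M 0 j)).
      exact: initial_continuous.
    exact: coord_continuous.
  exact: continuous_normc.
have invF j (a b : A) : same_orbit G a b -> F j a = F j b.
  move=> /asboolP ab.
  have : [set cmul u (val a) | u in G] (val a).
    by exists (const_mx 1) => //; apply/rowP => i; rewrite !mxE mul1r.
  rewrite ab => -[u Gu uab]; rewrite /F -uab mxE normcM.
  by rewrite (Gtorus u Gu j) mul1r.
have bF j : exists K : R, forall z : A, F j z <= K.
  pose Q := orbit_space G A.
  pose Fq : Q -> R := F j \o repr.
  have cFq : continuous Fq.
    apply: repr_comp_continuous => //= a b /eqP ab; apply/eqP/invF.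
    exact/(@eqmodP _ (@same_orbit_equiv R d G A)).
  have /compact_bounded [C [_ HC]] : compact (Fq @` [set: Q]).
    by apply: continuous_compact => //; exact: continuous_subspaceT.
  exists (`|C| + 1) => z.
  have -> : F j z = Fq (\pi_Q z)%qT.
    apply: invF; apply/(@eqmodP _ (@same_orbit_equiv R d G A)).
    by rewrite reprK.
  apply: le_trans (ler_norm _) _; apply: HC; last by exists (\pi_Q z)%qT.
  by rewrite (le_lt_trans (ler_norm C))// ltrDl.
have [K HK] : exists K : 'I_d -> R, forall j z, F j z <= K j.
  by exists (fun j => sval (cid (bF j))) => j; case: cid.
exists (\sum_j K j ^+ 2) => x [x0 xl] j; rewrite x0 /=.
pose z : Cd := \row_i ((Num.sqrt (x 0 i)) +i* 0).
have zx i : normc (z 0 i) ^+ 2 = x 0 i.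
  by rewrite mxE normc_sqr expr0n addr0 sqr_sqrtr.
have zA : A z.
  by rewrite /A /level_set /moment_map /= -xl; apply: eq_bigr => i _; rewrite zx.
have nz : 0 <= normc (z 0 j) by rewrite mxE sqrtr_ge0.
have zK := HK j (exist _ z (mem_set zA)); rewrite /F /= in zK.
rewrite -zx (bigD1 j)//= -[leLHS]addr0 lerD ?sumr_ge0// => [|i _].
  by rewrite lerXn2r// nnegrE (le_trans nz).
exact: sqr_ge0.
Qed.
End polytope_bounded.

(** * Polar coordinates in one complex variable *)

Section leb_recursion.
Context {R : realType}.
Local Notation mR := (measurableTypeR R).
Local Notation lam := (@lebesgue_measure R).
Local Open Scope ereal_scope.

(** Tonelli's theorem, applied to the product measure that [leb_step] transports. *)
Lemma ge0_integral_leb_cons n (h : n.+1.-tuple mR -> \bar R) :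
  measurable_fun [set: n.+1.-tuple mR] h -> (forall t, 0 <= h t) ->
  \int[leb n.+1]_t h t = \int[lam]_x \int[leb n]_t h (tcons (x, t)).
Proof.
move=> mh h0.
have mc := @measurable_tcons R n.
transitivity (\int[pushforward (lam \x leb n) (@tcons R n)]_t h t) => //.
rewrite ge0_integral_pushforward//= preimage_setT.
rewrite (fubini_tonelli1 (h \o @tcons R n))=> [//||p].
  exact: (measurableT_comp mh mc).
exact: h0.
Qed.

End leb_recursion.

Section plane.
Context {R : realType}.
Local Notation mR := (measurableTypeR R).
Local Notation lam := (@lebesgue_measure R).

(** The scaled measure agrees with Lebesgue measure on half-open intervals, hence
    everywhere by uniqueness of the extension. *)
Lemma lebesgue_measure_scale (s : R) (A : set mR) : 0 < s -> measurable A ->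
  (lam ((fun x : mR => s * x : mR)%R @^-1` A) = s^-1%:E * lam A)%E.
Proof.
move=> s0 mA.
have mphi : measurable_fun setT (fun x : mR => s * x : mR) by exact: mulrl_measurable.
pose push : {measure set mR -> \bar R} := pushforward lam (fun x : mR => s * x : mR).
have nns : (0 <= s)%R by exact: ltW.
pose m : {measure set mR -> \bar R} := mscale (NngNum nns) (push mphi).
have -> : lam A = m A; last first.
  by rewrite /m /push /= /mscale /= /pushforward muleA -EFinM mulVf ?mul1e// gt_eqF.
apply: (@lebesgue_measure_unique R m) => // _ [[a b] _ <-]; rewrite /m /push /= /mscale /= /pushforward.
rewrite (_ : _ @^-1` _ = `](a / s)%R, (b / s)%R]%classic); last first.
  apply/seteqP; split => x /=;
    by rewrite !in_itv /= ltr_pdivrMr// ler_pdivlMr// mulrC.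
rewrite !lebesgue_measure_itv/= !lte_fin ltr_pM2r ?invr_gt0//.
case: ifPn => _; last by rewrite mule0.
by rewrite -!EFinB -EFinM -mulrBl mulrCA divff ?mulr1// gt_eqF.
Qed.

Local Open Scope ereal_scope.

Lemma ge0_integral_scale (s : R) (g : mR -> \bar R) : (0 < s)%R ->
  measurable_fun setT g -> (forall x, 0 <= g x) ->
  \int[lam]_x g x = s%:E * \int[lam]_x g (s * x)%R.
Proof.
move=> s0 mg g0.
have mphi : measurable_fun setT (fun x : mR => s * x : mR)%R by exact: mulrl_measurable.
pose push : {measure set mR -> \bar R} := pushforward lam (fun x : mR => s * x : mR)%R.
have nns : (0 <= s)%R by exact: ltW.
pose m : {measure set mR -> \bar R} := mscale (NngNum nns) (push mphi).
rewrite (@eq_measure_integral _ _ _ _ m); last first.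
  move=> A mA _; rewrite /m /push /= /mscale /= /pushforward lebesgue_measure_scale//.
  by rewrite muleA -EFinM mulfV ?mul1e// gt_eqF.
by rewrite ge0_integral_mscale//= ge0_integral_pushforward//= preimage_setT.
Qed.

(** Polar coordinates in the plane, without angles: let [nu] be the image of plane
    Lebesgue measure by (x, y) |-> x^2 + y^2.  Dilating the plane by sqrt b multiplies
    areas by b, so the disc {x^2 + y^2 < b} has [nu]-measure b c with c the area of the
    unit disc.  Thus [nu] and c times Lebesgue measure on the half-line agree on the
    rays ]-oo, b[, which generate the Borel sets.  The constant c, which is pi,
    cancels from the quotient of two such integrals. *)
Lemma plane_radial_integral : exists2 c : R, (0 < c)%R &
  forall h : mR -> \bar R, measurable_fun setT h -> (forall r, 0 <= h r) ->
  \int[lam]_x \int[lam]_y h (x ^+ 2 + y ^+ 2)%R =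
  c%:E * \int[lam]_(r in `]0%R, +oo[) h r.
Proof.
pose q (p : mR * mR) : mR := (p.1 ^+ 2 + p.2 ^+ 2)%R.
have mq : measurable_fun setT q.
  by apply: measurable_funD; apply: (measurable_funX 2).
pose push : {measure set mR -> \bar R} := pushforward (lam \x lam) q.
pose nu := push mq.
have intnu (h : mR -> \bar R) : measurable_fun setT h -> (forall r, 0 <= h r) ->
    \int[nu]_r h r = \int[lam]_x \int[lam]_y h (x ^+ 2 + y ^+ 2)%R.
  move=> mh h0; rewrite /nu ge0_integral_pushforward//= preimage_setT.
  rewrite (fubini_tonelli1 (h \o q))//; last by move=> p; exact: h0.
  exact: (measurableT_comp mh mq).
have mray (b : R) : measurable (`]-oo, b[%classic : set mR) by exact: measurable_itv.
have mind (A : set mR) : measurable A ->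
    measurable_fun [set: mR] (fun r => (\1_A r)%:E : \bar R).
  by move=> mA; apply/measurable_EFinP; exact: measurable_indic.
have nu_ind A : measurable A -> nu A =
    \int[lam]_x \int[lam]_y (\1_A (x ^+ 2 + y ^+ 2)%R)%:E.
  move=> mA; rewrite -(intnu (fun r => (\1_A r)%:E)); first last.
  - by move=> r; rewrite lee_fin.
  - exact: mind.
  - by rewrite integral_indic// setIT.
have nu_ray (b : R) : (0 < b)%R ->
    nu `]-oo, b[%classic = b%:E * nu `]-oo, 1%R[%classic.
  move=> b0; set s := Num.sqrt b; have s0 : (0 < s)%R by rewrite sqrtr_gt0.
  have s2 : (s ^+ 2 = b)%R by rewrite sqr_sqrtr// ltW.
  have m2 (A : set mR) : measurable A ->
      measurable_fun [set: mR * mR] (fun p => (\1_A (q p))%:E : \bar R).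
    by move=> mA; exact: (measurableT_comp (mind _ mA) mq).
  have m1 (A : set mR) (x : mR) : measurable A ->
      measurable_fun [set: mR] (fun y : mR => (\1_A (x ^+ 2 + y ^+ 2)%R)%:E : \bar R).
    by move=> mA; exact: (measurableT_comp (m2 _ mA) (pair1_measurable x)).
  have mF (A : set mR) : measurable A -> measurable_fun [set: mR]
      (fun x : mR => \int[lam]_y (\1_A (x ^+ 2 + y ^+ 2)%R)%:E).
    move=> mA; apply: (@measurable_fun_fubini_tonelli_F _ _ _ _ _ _
      (fun p => (\1_A (q p))%:E)) => [|p]; [exact: m2|by rewrite lee_fin].
  have g0 (A : set mR) (x : mR) : 0 <= \int[lam]_y (\1_A (x ^+ 2 + y ^+ 2)%R)%:E.
    by apply: integral_ge0 => y _; rewrite lee_fin.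
  rewrite !nu_ind//.
  transitivity (s%:E * \int[lam]_x \int[lam]_y
      (\1_(`]-oo, b[%classic : set mR) ((s * x) ^+ 2 + y ^+ 2)%R)%:E).
    exact: (ge0_integral_scale s0 (mF _ (mray b)) (g0 _)).
  transitivity (s%:E * \int[lam]_x (s%:E * \int[lam]_y
      (\1_(`]-oo, 1%R[%classic : set mR) (x ^+ 2 + y ^+ 2)%R)%:E)).
    congr (_ * _); apply: eq_integral => x _.
    have h0 (y : mR) :
        0 <= (\1_(`]-oo, b[%classic : set mR) ((s * x) ^+ 2 + y ^+ 2)%R)%:E :> \bar R.
      by rewrite lee_fin.
    apply: etrans (ge0_integral_scale s0 (m1 _ (s * x)%R (mray b)) h0) _.
    congr (_ * _); apply: eq_integral => y _.
    rewrite !indicE !mem_setE !in_itv /= !exprMn -mulrDr s2.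
    by rewrite -ltr_pdivlMl// mulVf// gt_eqF.
  rewrite ge0_integralZl//=; [|exact: mF|by rewrite lee_fin ltW].
  by rewrite muleA -EFinM -expr2 s2.
have nu_ray0 (b : R) : (b <= 0)%R -> nu `]-oo, b[%classic = 0.
  move=> b0; rewrite /nu /= /pushforward (_ : _ @^-1` _ = set0) ?measure0//.
  apply/seteqP; split => // -[x y] /=; rewrite in_itv /= /q/= => xyb.
  by have := lt_le_trans xyb b0; rewrite ltNge addr_ge0// sqr_ge0.
have nu1_gt0 : 0 < nu `]-oo, 1%R[%classic.
  have mI : measurable (`]0%R, (2^-1)%R[%classic : set mR) by exact: measurable_itv.
  apply: (@lt_le_trans _ _ ((lam \x lam)
     (`]0%R, (2^-1)%R[%classic `*` `]0%R, (2^-1)%R[%classic))).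
    rewrite product_measure1E//= !lebesgue_measure_itv/= lte_fin invr_gt0 ltr0n.
    by rewrite -EFinB -EFinM lte_fin; lra.
  apply: (le_measure (lam \x lam)); rewrite ?inE//; first exact: measurableX.
    by rewrite -[X in measurable X]setTI; exact: (mq measurableT).
  move=> [x y] /=; rewrite !in_itv/= /q/= => -[/andP[x0 x1] /andP[y0 y1]].
  by nra.
have nu1_fin : nu `]-oo, 1%R[%classic < +oo.
  have mI : measurable (`](-2)%R, 2%R[%classic : set mR) by exact: measurable_itv.
  apply: (@le_lt_trans _ _ ((lam \x lam)
     (`](-2)%R, 2%R[%classic `*` `](-2)%R, 2%R[%classic))).
    apply: (le_measure (lam \x lam)); rewrite ?inE//; first last.
    - by move=> [x y] /=; rewrite !in_itv/= /q/= => h; split; apply/andP; nra.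
    - exact: measurableX.
    - by rewrite -[X in measurable X]setTI; exact: (mq measurableT).
  rewrite product_measure1E//= !lebesgue_measure_itv/= lte_fin.
  by case: ifP => _; rewrite ?mule0// -EFinB -EFinM ltry.
pose c := fine (nu `]-oo, 1%R[%classic).
have cE : nu `]-oo, 1%R[%classic = c%:E.
  by rewrite /c fineK// ge0_fin_numE.
have c0 : (0 < c)%R by rewrite -lte_fin -cE.
exists c => // h mh h0; rewrite -intnu//.
have nnc : (0 <= c)%R by exact: ltW.
have mpos : measurable (`]0%R, +oo[%classic : set mR) by exact: measurable_itv.
pose m2 : {measure set mR -> \bar R} := mscale (NngNum nnc) (mrestr lam mpos).
have num2 A : measurable A -> nu A = m2 A.
  apply: (@measure_unique _ R mR (@RGenInftyO.G R)
    (fun k => `]-oo, k%:R[%classic : set mR) _ _ _ _ nu m2).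
  - exact: RGenInftyO.measurableE.
  - move=> _ _ [x ->] [y ->]; exists (Num.min x y).
    apply/seteqP; split => z /=; rewrite !in_itv/= lt_min; first by case=> -> ->.
    by move=> /andP[].
  - by move=> i; exists i%:R.
  - apply/seteqP; split => // x _; exists (Num.bound `|x|%R) => //=.
    by rewrite in_itv/= (le_lt_trans (ler_norm x))// archi_boundP.
  - move=> _ [b ->]; rewrite /m2 /= /mscale /= /mrestr.
    have [b0|b0] := leP b 0%R.
      rewrite nu_ray0// (_ : _ `&` _ = set0) ?measure0 ?mule0//.
      apply/seteqP; split => // x /=; rewrite !in_itv/= andbT => -[xb x0].
      by have := lt_le_trans (lt_trans x0 xb) b0; rewrite ltxx.
    rewrite nu_ray// cE muleC (_ : _ `&` _ = `]0%R, b[%classic); last first.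
      apply/seteqP; split => x /=; rewrite !in_itv/= andbT; first by case=> -> ->.
      by move=> /andP[].
    by rewrite lebesgue_measure_itv/= lte_fin b0 -EFinB subr0.
  - move=> k; case: k => [|k]; first by rewrite nu_ray0//.
    by rewrite nu_ray// cE -EFinM ltry.
have mneg : measurable (`]-oo, 0%R]%classic : set mR) by exact: measurable_itv.
rewrite (@ge0_negligible_integral _ _ _ nu setT `]-oo, 0%R]%classic)//; last first.
  rewrite num2// /m2 /= /mscale /= /mrestr (_ : _ `&` _ = set0) ?measure0 ?mule0//.
  apply/seteqP; split => // x /=; rewrite !in_itv/= andbT => -[xb x0].
  by have := lt_le_trans x0 xb; rewrite ltxx.
rewrite (_ : setT `\` _ = `]0%R, +oo[%classic); last first.
  by rewrite setTD setCitvl.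
pose m3 : {measure set mR -> \bar R} := mscale (NngNum nnc) lam.
rewrite (@eq_measure_integral _ _ _ _ m3) ?ge0_integral_mscale//=.
  exact: measurable_funTS.
move=> A mA AS; rewrite num2// /m2 /m3 /= /mscale /= /mrestr.
by rewrite setIidl.
Qed.
End plane.

(** * Polar coordinates in several complex variables *)

Section tuple_measurability.
Context {R : realType}.
Local Notation mR := (measurableTypeR R).

Definition cat_tup m n (p : m.-tuple mR * n.-tuple mR) : (m + n).-tuple mR :=
  cat_tuple p.1 p.2.

Definition add_sqr n (s t : n.-tuple mR) : n.-tuple mR :=
  [tuple tnth s j ^+ 2 + tnth t j ^+ 2 | j < n].

(** The squared moduli of the coordinates z_j = u_j + i u_(n + j), in the layout
    chosen by [cvec_of_tuple]. *)
Definition sqr_moduli n (u : (n + n).-tuple mR) : n.-tuple mR :=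
  add_sqr [tuple tnth u (lshift n j) | j < n]
          [tuple tnth u (rshift n j) | j < n].

Definition pos_tuple n : set (n.-tuple mR) := [set r | forall j, 0 < tnth r j].

Lemma measurable_fun_tcons n d (T : measurableType d) (f : T -> mR)
    (g : T -> n.-tuple mR) :
  measurable_fun [set: T] f -> measurable_fun [set: T] g ->
  measurable_fun [set: T] (fun x => tcons (f x, g x)).
Proof.
move=> mf mg; have mfg : measurable_fun [set: T] (fun x => (f x, g x)).
  by apply/measurable_fun_pairP; split.
exact: (measurableT_comp (@measurable_tcons R n) mfg).
Qed.

Lemma measurable_tconsr n (x : mR) :
  measurable_fun [set: n.-tuple mR] (fun t => tcons (x, t)).
Proof. by apply: measurable_fun_tcons; [exact: measurable_cst|exact: measurable_id]. Qed.

Lemma measurable_cat_tup m n :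
  measurable_fun [set: m.-tuple mR * n.-tuple mR] (@cat_tup m n).
Proof.
apply/measurable_fun_tnthP => i; case: (split_ordP i) => j ->.
  rewrite (_ : _ \o _ = (fun t => tnth t j) \o fst); last first.
    by apply/funext => p /=; rewrite tnth_lshift.
  exact: (measurableT_comp (measurable_tnth j) measurable_fst).
rewrite (_ : _ \o _ = (fun t => tnth t j) \o snd); last first.
  by apply/funext => p /=; rewrite tnth_rshift.
exact: (measurableT_comp (measurable_tnth j) measurable_snd).
Qed.

Lemma measurable_add_sqr n d (T : measurableType d) (f g : T -> n.-tuple mR) :
  measurable_fun [set: T] f -> measurable_fun [set: T] g ->
  measurable_fun [set: T] (fun x => add_sqr (f x) (g x)).
Proof.
move=> mf mg; apply/measurable_fun_tnthP => i.
rewrite (_ : _ \o _ = fun x => tnth (f x) i ^+ 2 + tnth (g x) i ^+ 2 : mR).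
  apply: measurable_funD; apply: (measurable_funX 2).
    exact: (measurableT_comp (measurable_tnth i) mf).
  exact: (measurableT_comp (measurable_tnth i) mg).
by apply/funext => x /=; rewrite tnth_mktuple.
Qed.

Lemma measurable_sub_tuple m n (sigma : 'I_n -> 'I_m) :
  measurable_fun [set: m.-tuple mR]
    (fun u => [tuple tnth u (sigma j) | j < n] : n.-tuple mR).
Proof.
apply/measurable_fun_tnthP => i.
rewrite (_ : _ \o _ = fun u => tnth u (sigma i)); first exact: measurable_tnth.
by apply/funext => u /=; rewrite tnth_mktuple.
Qed.

Lemma measurable_pos_tuple n : measurable (@pos_tuple n).
Proof.
rewrite (_ : @pos_tuple n = \bigcap_(j in [set: 'I_n])
    ((fun r : n.-tuple mR => tnth r j) @^-1` `]0, +oo[%classic)).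
  apply: fin_bigcap_measurable => [|j _]; first exact: finite_finset.
  rewrite -[X in measurable X]setTI; apply: (measurable_tnth j) => //.
apply/seteqP; split => r /= h j; first by rewrite /= in_itv/= h.
by have := h j I; rewrite /= in_itv/= andbT.
Qed.

Lemma add_sqr_tcons n (x y : mR) (s t : n.-tuple mR) :
  add_sqr (tcons (x, s)) (tcons (y, t)) = tcons (x ^+ 2 + y ^+ 2, add_sqr s t).
Proof.
apply/eq_from_tnth => i; rewrite tnth_mktuple.
by case: (unliftP ord0 i) => [j|] ->; rewrite ?tnthS ?tnth0 // tnth_mktuple.
Qed.

Lemma pos_tuple_tcons n (x : mR) (s : n.-tuple mR) :
  pos_tuple (tcons (x, s)) <-> 0 < x /\ pos_tuple s.
Proof.
split => [h|[x0 h] i].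
  by split => [|j]; [have := h ord0|have := h (lift ord0 j)];
    rewrite ?tnthS ?tnth0.
by case: (unliftP ord0 i) => [j|] ->; rewrite ?tnthS ?tnth0.
Qed.

End tuple_measurability.

Section complex_integral.
Context {R : realType}.
Local Notation mR := (measurableTypeR R).
Local Notation lam := (@lebesgue_measure R).
Local Open Scope ereal_scope.

Lemma ge0_integral_leb0 (h : 0.-tuple mR -> \bar R) :
  \int[leb 0]_t h t = h [tuple].
Proof.
transitivity (\int[\d_([tuple] : 0.-tuple mR)]_t h t) => //.
rewrite (_ : h = cst (h [tuple])); last by apply/funext => t; rewrite (tuple0 t).
by rewrite integral_cst//= diracE in_setT mule1.
Qed.

(** Integration over R^(m + n) iterated as an integral over R^m and one over R^n;
    used to separate the real parts from the imaginary parts. *)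
Lemma ge0_integral_leb_cat m n (h : (m + n).-tuple mR -> \bar R) :
  measurable_fun [set: (m + n).-tuple mR] h -> (forall t, 0 <= h t) ->
  \int[leb (m + n)]_t h t =
  \int[leb m]_s \int[leb n]_t h (cat_tup (s, t)).
Proof.
elim: m h => [|m IH] h mh h0.
  rewrite ge0_integral_leb0; apply: eq_integral => t _; congr h.
  exact: val_inj.
rewrite [LHS](@ge0_integral_leb_cons R (m + n))//.
rewrite [RHS]ge0_integral_leb_cons; first last.
- by move=> s; exact: integral_ge0.
- apply: (@measurable_fun_fubini_tonelli_F _ _ _ _ _ _ (h \o @cat_tup R m.+1 n)).
    exact: (measurableT_comp mh (@measurable_cat_tup R m.+1 n)).
  by move=> p; exact: h0.
apply: eq_integral => x _.
have mhx := measurableT_comp mh (@measurable_tconsr R (m + n) x).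
apply: etrans (IH _ mhx (fun t => h0 _)) _.
apply: eq_integral => s _; apply: eq_integral => t _; congr h.
exact: val_inj.
Qed.

Lemma ge0_integral_leb_pos_tuple_cons n (h : n.+1.-tuple mR -> \bar R) :
  measurable_fun [set: n.+1.-tuple mR] h -> (forall t, 0 <= h t) ->
  \int[leb n.+1]_(r in @pos_tuple R n.+1) h r =
  \int[lam]_(x in `]0%R, +oo[) \int[leb n]_(r in @pos_tuple R n) h (tcons (x, r)).
Proof.
move=> mh h0; rewrite integral_mkcond [RHS]integral_mkcond.
rewrite ge0_integral_leb_cons//; first last.
- by move=> t; apply: erestrict_ge0.
- by apply/(measurable_restrictT _ _).1; [exact: measurable_pos_tuple|exact: measurable_funTS].
apply: eq_integral => x _; rewrite patchE; case: ifPn => [|x0].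
  rewrite inE/= in_itv/= andbT => x0.
  rewrite [RHS]integral_mkcond; apply: eq_integral => t _; rewrite !patchE.
  congr (if _ then _ else _); apply/idP/idP; rewrite !inE.
    by case/pos_tuple_tcons.
  by move=> t0; apply/pos_tuple_tcons.
rewrite integral0_eq// => t _; rewrite patchE ifN//; apply: contra x0.
by rewrite !inE/= in_itv/= andbT => /pos_tuple_tcons[].
Qed.

(** By induction on the dimension.  Tonelli brings the first real part x next to the
    first imaginary part y, past the remaining real parts; the induction hypothesis
    integrates out the other coordinates and [plane_radial_integral] treats (x, y). *)
Lemma ge0_radial_integral n : exists2 c : R, (0 < c)%R &
  forall h : n.-tuple mR -> \bar R, measurable_fun [set: n.-tuple mR] h ->
    (forall t, 0 <= h t) ->
  \int[leb n]_s \int[leb n]_t h (add_sqr s t) =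
  c%:E * \int[leb n]_(r in @pos_tuple R n) h r.
Proof.
have [c c0 plane] := @plane_radial_integral R.
exists (c ^+ n)%R; first by rewrite exprn_gt0.
elim: n => [|n IH] h mh h0.
  rewrite !ge0_integral_leb0 expr0 mul1e (_ : @pos_tuple R 0 = setT); last first.
    by apply/seteqP; split => // r _ [].
  by rewrite ge0_integral_leb0; congr h; exact: tuple0.
have mk (x : mR) : measurable_fun [set: mR * n.-tuple mR]
    (fun p => \int[leb n]_t h (tcons (x ^+ 2 + p.1 ^+ 2, add_sqr p.2 t)%R)).
  pose g (q : (mR * n.-tuple mR) * n.-tuple mR) : n.+1.-tuple mR :=
    tcons (x ^+ 2 + q.1.1 ^+ 2, add_sqr q.1.2 q.2)%R.
  apply: (@measurable_fun_fubini_tonelli_F _ _ _ _ _ _ (h \o g)); last by move=> q; exact: h0.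
  apply: (measurableT_comp mh); apply: measurable_fun_tcons.
    apply: measurable_funD => //; apply: (measurable_funX 2).
    exact: (measurableT_comp measurable_fst measurable_fst).
  apply: measurable_add_sqr => //.
  exact: (measurableT_comp measurable_snd measurable_fst).
have mG : measurable_fun [set: mR]
    (fun x : mR => \int[leb n]_(r in @pos_tuple R n) h (tcons (x, r))).
  rewrite (_ : (fun x => _) = fun x => \int[leb n]_r
      ((h \o @tcons R n) \_ (setT `*` @pos_tuple R n)) (x, r)); last first.
    apply/funext => x; rewrite integral_mkcond; apply: eq_integral => r _.
    by rewrite !patchE in_setX in_setT.
  apply: (@measurable_fun_fubini_tonelli_F _ _ _ _ _ _
    ((h \o @tcons R n) \_ (setT `*` @pos_tuple R n))); last first.
    by move=> p; apply: erestrict_ge0 => q _; exact: h0.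
  apply/(measurable_restrictT _ _).1.
    by apply: measurableX => //; exact: measurable_pos_tuple.
  by apply: measurable_funTS; exact: (measurableT_comp mh (@measurable_tcons R n)).
have mradd (s : n.+1.-tuple mR) :
    measurable_fun [set: n.+1.-tuple mR] (fun u => h (add_sqr s u)).
  apply: (measurableT_comp mh).
  by apply: measurable_add_sqr; [exact: measurable_cst|exact: measurable_id].
have mF : measurable_fun [set: n.+1.-tuple mR]
    (fun s => \int[leb n.+1]_u h (add_sqr s u)).
  apply: (@measurable_fun_fubini_tonelli_F _ _ _ _ _ _
    (h \o (fun p => add_sqr p.1 p.2))); last by move=> p; exact: h0.
  apply: (measurableT_comp mh).
  by apply: measurable_add_sqr; [exact: measurable_fst|exact: measurable_snd].
transitivity (\int[lam]_x \int[lam]_y \int[leb n]_s \int[leb n]_t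
    h (tcons (x ^+ 2 + y ^+ 2, add_sqr s t)%R)).
  rewrite ge0_integral_leb_cons//; last by move=> t; exact: integral_ge0.
  apply: eq_integral => x _; rewrite (fubini_tonelli _ (mk x)) /=; last first.
    by move=> p; exact: integral_ge0.
  apply: eq_integral => s _.
  apply: etrans (ge0_integral_leb_cons (mradd _) (fun u => h0 _)) _.
  apply: eq_integral => y _; apply: eq_integral => t _.
  by rewrite add_sqr_tcons.
transitivity (\int[lam]_x \int[lam]_y ((c ^+ n)%:E *
   \int[leb n]_(r in @pos_tuple R n) h (tcons (x ^+ 2 + y ^+ 2, r)%R))).
  apply: eq_integral => x _; apply: eq_integral => y _.
  rewrite (IH (fun r => h (tcons (x ^+ 2 + y ^+ 2, r)%R)))//.
  exact: (measurableT_comp mh (@measurable_tconsr R n _)).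
rewrite (plane (fun x => (c ^+ n)%:E *
   \int[leb n]_(r in @pos_tuple R n) h (tcons (x, r)%R))); first last.
- by move=> r; rewrite mule_ge0 ?lee_fin ?exprn_ge0 ?(ltW c0)//; exact: integral_ge0.
- exact: measurable_funeM.
rewrite ge0_integralZl//; first last.
- by rewrite lee_fin exprn_ge0// ltW.
- by move=> x _; exact: integral_ge0.
- exact: measurable_funTS.
by rewrite muleA -EFinM -exprS ge0_integral_leb_pos_tuple_cons.
Qed.

(** Integrands of arbitrary sign, through positive and negative parts: multiplication
    by the finite positive c distributes over their difference even when one or both
    of the two integrals are infinite. *)
Lemma radial_integral n : exists2 c : R, (0 < c)%R &
  forall h : n.-tuple mR -> \bar R, measurable_fun [set: n.-tuple mR] h ->
  \int[leb (n + n)]_u h (sqr_moduli u) =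
  c%:E * \int[leb n]_(r in @pos_tuple R n) h r.
Proof.
have [c c0 polar] := ge0_radial_integral n; exists c => // h mh.
pose q := @sqr_moduli R n.
have mq : measurable_fun [set: (n + n).-tuple mR] q.
  by apply: measurable_add_sqr; exact: measurable_sub_tuple.
have ge0 g : measurable_fun [set: n.-tuple mR] g -> (forall r, 0 <= g r) ->
    \int[leb (n + n)]_u g (q u) = c%:E * \int[leb n]_(r in @pos_tuple R n) g r.
  move=> mg g0; rewrite -(polar g mg g0).
  have mgq := measurableT_comp mg mq.
  apply: etrans (ge0_integral_leb_cat mgq (fun u => g0 (q u))) _.
  apply: eq_integral => s _; apply: eq_integral => t _; congr g.
  congr add_sqr; apply/eq_from_tnth => i; rewrite tnth_mktuple.
    by rewrite tnth_lshift.
  by rewrite tnth_rshift.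
rewrite [LHS](@integralE _ _ _ (leb (n + n)) setT (h \o q)).
rewrite funepos_comp funeneg_comp /=.
rewrite [in RHS]integralE.
rewrite (ge0 h^\+)//; last exact: measurable_funepos.
rewrite (ge0 h^\-)//; last exact: measurable_funeneg.
have := @integral_ge0 _ _ _ (leb n) (@pos_tuple R n) h^\+ (fun _ _ => funepos_ge0 h _).
have := @integral_ge0 _ _ _ (leb n) (@pos_tuple R n) h^\- (fun _ _ => funeneg_ge0 h _).
have cy : c%:E * +oo = +oo by rewrite gt0_muley ?lte_fin.
have cNy : c%:E * -oo = -oo by rewrite gt0_muleNy ?lte_fin.
case: (\int[leb n]_(r in _) h^\- r) => [a| |]//;
  case: (\int[leb n]_(r in _) h^\+ r) => [b| |]// _ _.
- by transitivity ((c * b - c * a)%:E) => //; rewrite -mulrBr.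
- by rewrite (_ : +oo - a%:E = +oo)// cy.
- by rewrite (_ : b%:E - +oo = -oo)// cy cNy.
- by rewrite (_ : +oo - +oo = -oo)// cy cNy.
Qed.

Lemma Rintegral_sqr_moduli n : exists2 c : R, (0 < c)%R &
  forall h : n.-tuple mR -> R, measurable_fun [set: n.-tuple mR] h ->
  (\int[leb (n + n)]_u h (sqr_moduli u) =
   c * \int[leb n]_(t in @pos_tuple R n) h t)%R.
Proof.
have [c c0 HC] := radial_integral n; exists c => // h mh.
rewrite /Rintegral (HC (EFin \o h)); last exact/measurable_EFinP.
case: (integral _ _ _) => [r| |] //=.
  by rewrite gt0_muley ?lte_fin//= mulr0.
by rewrite gt0_muleNy ?lte_fin//= mulr0.
Qed.

End complex_integral.

(** * Measurability of continuous functions *)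

Section continuous_measurability.
Context {R : realType}.
Local Notation mR := (measurableTypeR R).

Lemma cvg_row n (u : nat -> 'rV[R]_n) (v : 'rV[R]_n) :
  (forall i, u k 0 i @[k --> \oo] --> v 0 i) -> u k @[k --> \oo] --> v.
Proof.
move=> uv; apply/cvg_ballP => e e0.
suff : \forall k \near \oo, forall i, ball (v 0 i) e (u k 0 i).
  by apply: filterS => k h; split => // i j; rewrite (ord1 i).
by apply: filter_forall => i; exact: (cvg_ball (uv i)).
Qed.

(** Together with [grid_index], rounds a point down to the grid of mesh 1 / (k + 1):
    a continuous function is the pointwise limit of its values at the rounded points,
    which take countably many values. *)
Definition grid_point n (k : nat) (z : 'rV[int]_n) : 'rV[R]_n :=
  \row_i ((z 0 i)%:~R / k.+1%:R).

Definition grid_index n (k : nat) (t : n.-tuple mR) : 'rV[int]_n :=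
  \row_i Num.floor (k.+1%:R * tnth t i).

Lemma cvg_grid n (t : n.-tuple mR) :
  grid_point k (grid_index k t) @[k --> \oo] --> vec_of_tuple t.
Proof.
apply: cvg_row => i; rewrite mxE.
rewrite (_ : (fun k => _) = fun k : nat =>
    (Num.floor (k.+1%:R * tnth t i))%:~R / k.+1%:R); last first.
  by apply/funext => k; rewrite !mxE.
apply: (@squeeze_cvgr _ _ _ _ (fun k : nat => tnth t i - k.+1%:R^-1)
  (fun=> tnth t i)); last 2 first.
- rewrite -[X in _ --> X]subr0; apply: cvgB; first exact: cvg_cst.
  exact: cvg_harmonic.
- exact: cvg_cst.
near=> k; have k0 : 0 < k.+1%:R :> R by [].
have /andP[h1 /ltW h2] := floor_itv (k.+1%:R * tnth t i).
apply/andP; split; last by rewrite ler_pdivrMr// [leRHS]mulrC.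
rewrite ler_pdivlMr// mulrBl mulVf ?gt_eqF// mulrC lerBlDr.
by rewrite (le_trans h2)// intrD.
Unshelve. all: by end_near. Qed.

(** The sigma-algebra on tuples is generated by the coordinates, not by the open
    sets of the row-vector topology; the two are reconciled by approximating a
    continuous function by functions that are constant on the cells of a grid. *)
Lemma continuous_measurable_tuple n (f : 'rV[R]_n -> R) : continuous f ->
  measurable_fun [set: n.-tuple mR] (fun t => f (vec_of_tuple t)).
Proof.
move=> cf.
apply: (@measurable_fun_cvg _ _ _ _
  (fun k t => f (grid_point k (grid_index k t)))) => [k|t _]; last first.
  exact: (cvg_comp _ _ (@cvg_grid n t) (cf _)).
move=> _ B mB; rewrite setTI.
rewrite (_ : _ @^-1` _ = \bigcup_(z in [set: 'rV[int]_n])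
   (if `[< B (f (grid_point k z)) >] then [set t | grid_index k t = z] else set0)).
  apply: countable_bigcupT_measurable => // z; case: ifPn => // _.
  rewrite (_ : mkset _ = \bigcap_(i in [set: 'I_n])
    ((fun t : n.-tuple mR => tnth t i) @^-1`
      `[(z 0 i)%:~R / k.+1%:R, (z 0 i + 1)%:~R / k.+1%:R[%classic)).
    apply: fin_bigcap_measurable => [|j _]; first exact: finite_finset.
    by rewrite -[X in measurable X]setTI; apply: (measurable_tnth j) => //.
  apply/seteqP; split => t /=.
    move=> <- i _ /=; rewrite in_itv/= !mxE ler_pdivrMr// ltr_pdivlMr//.
    by rewrite ![_ * k.+1%:R]mulrC floor_itv.
  move=> h; apply/rowP => i; rewrite mxE; have /= := h i I.
  rewrite in_itv/= ler_pdivrMr// ltr_pdivlMr// ![_ * k.+1%:R]mulrC => h'.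
  exact/floor_def.
apply/seteqP; split => t /=.
  by move=> Bt; exists (grid_index k t) => //; rewrite ifT//; exact/asboolP.
by move=> [z _]; case: asboolP => // Bz /= ->.
Qed.
End continuous_measurability.

(** * The gamma integral *)

#[local] Instance is_derive_exprn {R : realType} (n : nat) (x : R) :
  is_derive x 1 (fun y : R => y ^+ n) (n%:R * x ^+ n.-1).
Proof.
rewrite (_ : (fun y : R => _) = (@id R) ^+ n).
  by apply: is_derive_eq; rewrite /GRing.scale /= mulr1.
by rewrite exprfctE.
Qed.

Section gamma_integral.
Context {R : realType}.
Local Notation lam := (@lebesgue_measure R).
Variable a : R.
Hypothesis a0 : 0 < a.

Definition gamma_fun (n : nat) (y : R) : R := y ^+ n * expR (- (a * y)).

(** The primitive of [gamma_fun n] given by repeated integration by parts that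
    vanishes at infinity. *)
Fixpoint gamma_primitive (n : nat) (y : R) : R :=
  match n with
  | 0 => - (a^-1 * expR (- (a * y)))
  | n'.+1 => n'.+1%:R / a * gamma_primitive n' y - a^-1 * gamma_fun n'.+1 y
  end.

Lemma cvg_gamma_fun n : gamma_fun n y @[y --> +oo] --> 0.
Proof.
pose C := (n.+1)`!%:R / a ^+ n.+1.
apply: (@squeeze_cvgr _ _ _ _ (fun=> 0) (fun y => C * y^-1)); last 2 first.
- exact: cvg_cst.
- rewrite -[X in _ --> X](mulr0 C); apply: cvgMr.
  by apply/gtr0_cvgV0; [exact: nbhs_pinfty_gt|exact: cvg_id].
near=> y; have y0 : 0 < y by [].
rewrite /gamma_fun mulr_ge0 ?exprn_ge0 ?expR_ge0 ?(ltW y0)//=.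
have h : (a * y) ^+ n.+1 / (n.+1)`!%:R <= expR (a * y).
  apply: le_trans (expR_ge1Dxn n _); first by rewrite lerDr.
  by rewrite mulr_ge0// ltW.
rewrite expRN ler_pdivrMr ?expR_gt0// -mulrA.
have D0 : 0 < (a * y) ^+ n.+1 / (n.+1)`!%:R.
  by rewrite divr_gt0 ?exprn_gt0 ?mulr_gt0 ?ltr0n ?fact_gt0.
rewrite [leLHS](_ : _ = C * (y^-1 * ((a * y) ^+ n.+1 / (n.+1)`!%:R))).
  by rewrite !ler_wpM2l ?invr_ge0 ?(ltW y0)// divr_ge0 ?exprn_ge0 ?ltW.
rewrite /C exprMn [y ^+ n.+1]exprS; field.
by rewrite !gt_eqF ?exprn_gt0 ?ltr0n ?fact_gt0.
Unshelve. all: by end_near. Qed.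

Lemma cvg_gamma_primitive n : gamma_primitive n y @[y --> +oo] --> 0.
Proof.
elim: n => [|n IH].
  rewrite (_ : gamma_primitive 0 = fun y => - (a^-1 * gamma_fun 0 y)).
    rewrite -oppr0 -[X in - X](mulr0 a^-1); apply: cvgN; apply: cvgMr.
    exact: cvg_gamma_fun.
  by apply/funext => y; rewrite /gamma_fun mul1r.
rewrite -[X in _ --> X](subrr 0) /=; apply: cvgB.
  by rewrite -[X in _ --> X](mulr0 (n.+1%:R / a)); exact: cvgMr.
by rewrite -[X in _ --> X](mulr0 a^-1); apply: cvgMr; exact: cvg_gamma_fun.
Qed.

Lemma is_derive_gamma_primitive n (y : R) :
  is_derive y 1 (gamma_primitive n) (gamma_fun n y).
Proof.
elim: n => [|n IH] /=.
  apply: is_derive_eq; rewrite /gamma_fun mul1r /GRing.scale /=.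
  by field; rewrite gt_eqF.
rewrite /gamma_fun; apply: is_derive_eq; rewrite /gamma_fun /GRing.scale /= exprS.
by field; rewrite gt_eqF.
Qed.

Lemma gamma_primitive0 n : gamma_primitive n 0 = - (n`!%:R / a ^+ n.+1).
Proof.
elim: n => [|n IH] /=; first by rewrite mulr0 oppr0 expR0 mulr1 expr1 div1r.
rewrite IH /gamma_fun expr0n /= mul0r mulr0 subr0 factS natrM [a ^+ n.+2]exprS.
by rewrite mulrN; congr (- _); rewrite mulf_div.
Qed.

Lemma continuous_gamma_fun n : continuous (gamma_fun n).
Proof.
move=> y.
apply: differentiable_continuous; apply/derivable1_diffP.
rewrite /gamma_fun; exact: ex_derive.
Qed.

Lemma integral_gamma_fun n :
  (\int[lam]_(y in `]0%R, +oo[) (gamma_fun n y)%:E = (n`!%:R / a ^+ n.+1)%:E)%E.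
Proof.
rewrite integral_itv_obnd_cbnd; last first.
  apply/measurable_EFinP; apply: measurable_funTS.
  by apply: continuous_measurable_fun; exact: continuous_gamma_fun.
rewrite (@ge0_continuous_FTC2y _ _ (gamma_primitive n) _ 0).
- by rewrite gamma_primitive0 -EFinB opprK add0r.
- by move=> x x0; rewrite mulr_ge0 ?exprn_ge0 ?expR_ge0.
- exact/continuous_subspaceT/continuous_gamma_fun.
- exact: cvg_gamma_primitive.
- by move=> x _; have [] := is_derive_gamma_primitive n x.
- apply/cvg_at_right_filter/differentiable_continuous/derivable1_diffP.
  by have [] := is_derive_gamma_primitive n 0.
- move=> x _; rewrite derive1E; have := is_derive_gamma_primitive n x.
  by move=> ?; rewrite derive_val.
Qed.
End gamma_integral.

(** * Moments of the gamma law *)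

Section gamma_moments.
Context {R : realType}.
Implicit Types (s : R) (p q : {poly R}).

(** The linear functional X^i |-> (s + 1) ... (s + i): for a natural number s it is
    the expectation under the gamma law with density y^s e^(-y) / s!. *)
Definition gamma_mean s p : R := \sum_(i < size p) p`_i * rising s i.

(** The centered moment E (Y - s)^m of that law. *)
Definition gamma_moment (m : nat) s : R := gamma_mean s (('X - s%:P) ^+ m).

Lemma risingS s i : rising s i.+1 = rising s i * (s + i.+1%:R).
Proof. by rewrite /rising big_ord_recr. Qed.

Lemma risingSl s i : rising s i.+1 = (s + 1) * rising (s + 1) i.
Proof.
rewrite /rising big_ord_recl; congr (_ * _); apply: eq_bigr => j _.
by rewrite lift0 -[j.+2]add1n natrD addrA.
Qed.

Lemma gamma_meanE n s p : (size p <= n)%N ->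
  gamma_mean s p = \sum_(i < n) p`_i * rising s i.
Proof.
move=> pn; rewrite /gamma_mean -!(big_mkord xpredT (fun i => p`_i * rising s i)).
rewrite [RHS](@big_cat_nat _ _ _ (size p))//= [X in _ + X]big1_seq ?addr0// => i.
by rewrite mem_index_iota => /andP[_ /andP[pi _]]; rewrite nth_default// mul0r.
Qed.

Lemma gamma_meanD s p q : gamma_mean s (p + q) = gamma_mean s p + gamma_mean s q.
Proof.
pose n := maxn (size p) (size q).
rewrite !(@gamma_meanE n) ?leq_maxl ?leq_maxr//; last exact: size_polyD.
by rewrite -big_split; apply: eq_bigr => i _; rewrite coefD mulrDl.
Qed.

Lemma gamma_meanZ s c p : gamma_mean s (c *: p) = c * gamma_mean s p.
Proof.
rewrite !(@gamma_meanE (size p)) ?size_scale_leq// mulr_sumr.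
by apply: eq_bigr => i _; rewrite coefZ mulrA.
Qed.

Lemma gamma_meanMn s p n : gamma_mean s (p *+ n) = n%:R * gamma_mean s p.
Proof. by rewrite -gamma_meanZ scaler_nat. Qed.

Lemma gamma_mean_sum s (I : finType) (F : I -> {poly R}) :
  gamma_mean s (\sum_i F i) = \sum_i gamma_mean s (F i).
Proof.
apply: (big_morph _ (gamma_meanD s)).
by rewrite /gamma_mean size_poly0 big_ord0.
Qed.

Lemma gamma_meanXn s n : gamma_mean s 'X^n = rising s n.
Proof.
rewrite /gamma_mean size_polyXn big_ord_recr /= coefXn eqxx mul1r big1 ?add0r//.
by move=> i _; rewrite coefXn ltn_eqF ?mul0r.
Qed.

Lemma gamma_mean0 s : gamma_mean s 0 = 0.
Proof. by rewrite /gamma_mean size_poly0 big_ord0. Qed.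

Lemma gamma_mean1 s : gamma_mean s 1 = 1.
Proof. by have := gamma_meanXn s 0; rewrite expr0 /rising big_ord0. Qed.

Lemma gamma_mean_cons s p c :
  gamma_mean s (p * 'X + c%:P) = (s + 1) * gamma_mean (s + 1) p + c.
Proof.
rewrite gamma_meanD -[c%:P]mulr1 mul_polyC gamma_meanZ gamma_mean1 mulr1.
congr (_ + _).
rewrite (@gamma_meanE (size p).+1); last by rewrite (leq_trans (size_polyMleq _ _))// size_polyX addn2.
rewrite big_ord_recl coefMX mul0r add0r /gamma_mean mulr_sumr.
by apply: eq_bigr => i _; rewrite coefMX lift0 /= risingSl mulrCA.
Qed.

(** The identity E (Y h(Y)) = (s + 1) E h(Y) + E (Y h'(Y)), which integration by
    parts gives for the gamma law; here it holds for every real s, coefficient by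
    coefficient. *)
Lemma gamma_mean_stein s p :
  gamma_mean s (p * 'X) = (s + 1) * gamma_mean s p + gamma_mean s (p^`() * 'X).
Proof.
have sX q : (size (q * 'X)%R <= (size q).+1)%N.
  by rewrite (leq_trans (size_polyMleq _ _))// size_polyX addn2.
rewrite (@gamma_meanE (size p).+2 s (p * 'X)); last by rewrite (leq_trans (sX _)).
rewrite !(@gamma_meanE (size p).+1); first last.
- by rewrite leqnSn.
- rewrite (leq_trans (sX _))// ltnS (leq_trans (size_poly _ _))//.
  by rewrite leq_pred.
rewrite big_ord_recl coefMX mul0r add0r mulr_sumr -big_split /=.
apply: eq_bigr => i _; rewrite /bump leq0n add1n !coefMX /= risingS coef_deriv.
case: i => -[|i] ilt /=; first by rewrite mul0r addr0; ring.
by rewrite -mulr_natr; ring.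
Qed.

Lemma gamma_moment0 s : gamma_moment 0 s = 1.
Proof. by rewrite /gamma_moment expr0 gamma_mean1. Qed.

(** Apply [gamma_mean_stein] to (X - s)^m and write X = (X - s) + s. *)
Lemma gamma_momentS m s :
  gamma_moment m.+1 s = m.+1%:R * gamma_moment m s + m%:R * s * gamma_moment m.-1 s.
Proof.
pose Y := 'X - s%:P; have XE : 'X = Y + s%:P by rewrite subrK.
have mulY m' : gamma_mean s (Y ^+ m' * 'X) =
    gamma_moment m'.+1 s + s * gamma_moment m' s.
  by rewrite [in 'X]XE mulrDr -exprSr gamma_meanD mulrC mul_polyC gamma_meanZ.
have := gamma_mean_stein s (Y ^+ m); rewrite mulY.
have dY : Y^`() = 1 by exact: derivXsubC.
rewrite deriv_exp dY mul1r; case: m => [|m].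
  rewrite mulr0n mul0r gamma_mean0 -/(gamma_moment 0 s).
  by move=> /(canRL (addrK _)) ->; ring.
rewrite [_ * 'X]mulrnAl gamma_meanMn mulY /= -/(gamma_moment m.+1 s).
by move=> /(canRL (addrK _)) ->; ring.
Qed.

(** Each application of the recurrence [gamma_momentS] either keeps the power of
    s + 1 or raises it by one while m grows by two. *)
Lemma gamma_moment_bound m : exists2 C : R, 0 <= C &
  forall s, 0 <= s -> 0 <= gamma_moment m s <= C * (s + 1) ^+ m./2.
Proof.
suff [] : (exists2 C : R, 0 <= C &
    forall s, 0 <= s -> 0 <= gamma_moment m s <= C * (s + 1) ^+ m./2) /\
  (exists2 C : R, 0 <= C & forall s, 0 <= s ->
     0 <= gamma_moment m.+1 s <= C * (s + 1) ^+ m.+1./2) by [].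
elim: m => [|m [[C C0 IHC] [D D0 IHD]]].
  split; exists 1 => // s s0; rewrite ?gamma_momentS gamma_moment0 expr0;
    by rewrite ?mul0r ?addr0 !mulr1 ler01 lexx.
split; first by exists D.
exists (m.+2%:R * D + m.+1%:R * C) => [|s s0].
  by rewrite addr_ge0 ?mulr_ge0.
have /andP[c0 c1] := IHC s s0; have /andP[d0 d1] := IHD s s0.
rewrite gamma_momentS /= addr_ge0 ?mulr_ge0//=.
have s1 : 1 <= s + 1 by rewrite lerDr.
rewrite [leRHS]mulrDl lerD//.
  rewrite -mulrA ler_wpM2l// (le_trans d1)// ler_wpM2l// ler_weXn2l//.
  exact: (half_leq (leqnSn m.+1)).
rewrite -!mulrA ler_wpM2l// exprS mulrCA ler_pM//.
by rewrite lerDl.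
Qed.

(** Binomial expansion of (X - s)^m. *)
Lemma gamma_momentE m s : gamma_moment m s = m`!%:R * g1 m s.
Proof.
rewrite /g1 mulrA divff ?mul1r; last by rewrite pnatr_eq0 -lt0n fact_gt0.
rewrite /gamma_moment exprBn gamma_mean_sum; apply: eq_bigr => i _.
rewrite -[s%:P ^+ i]rmorphXn /= [X in X *+ _](_ : _ = ((-1) ^+ i * s ^+ i) *: 'X^(m - i)).
  by rewrite gamma_meanMn gamma_meanZ gamma_meanXn; ring.
by rewrite -mul_polyC !polyCM !polyC_exp polyCN mulrAC.
Qed.

End gamma_moments.

(** * Integrals of products over R^n *)

Section product_integral.
Context {R : realType}.
Local Notation mR := (measurableTypeR R).
Local Notation lam := (@lebesgue_measure R).
Local Open Scope ereal_scope.

(** Fubini's theorem, by induction on the number of factors. *)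
Lemma integral_prod_tuple n (g : 'I_n -> mR -> R) :
  (forall j, lam.-integrable setT (EFin \o g j)) ->
  (leb n).-integrable [set: n.-tuple mR]
    (fun t => (\prod_j g j (tnth t j))%:E) /\
  (\int[leb n]_t (\prod_j g j (tnth t j)) = \prod_j \int[lam]_x g j x)%R.
Proof.
elim: n g => [|n IH] g ig.
  have E (t : 0.-tuple mR) : (\prod_j g j (tnth t j) = 1)%R by rewrite big_ord0.
  split.
    rewrite (_ : (fun _ => _) = cst 1); last by apply/funext => t; rewrite E.
    apply/integrableP; split; first exact: measurable_cst.
    by rewrite ge0_integral_leb0 /= normr1 ltry.
  by rewrite /Rintegral ge0_integral_leb0 E big_ord0.
have [iP IP] := IH _ (fun j => ig (lift ord0 j)).
pose P (t : n.-tuple mR) := (\prod_j g (lift ord0 j) (tnth t j))%R.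
have {}iP : (leb n).-integrable setT (EFin \o P) by [].
have mP : measurable_fun [set: n.-tuple mR] P.
  by move/measurable_int : iP => /measurable_EFinP.
have mnP : measurable_fun [set: n.-tuple mR] (fun t => `|P t|%:E).
  by apply/measurable_EFinP; exact: (measurableT_comp (@normr_measurable R setT) mP).
have cE (x : mR) (t : n.-tuple mR) :
    (\prod_j g j (tnth (tcons (x, t)) j) = g ord0 x * P t)%R.
  rewrite big_ord_recl tnth0; congr (_ * _)%R.
  by apply: eq_bigr => j _; rewrite tnthS.
have mg j : measurable_fun [set: mR] (g j).
  by have /measurable_int/measurable_EFinP := ig j.
have mh : measurable_fun [set: n.+1.-tuple mR]
    (fun t => (\prod_j g j (tnth t j))%:E).
  apply/measurable_EFinP; apply: measurable_prod => j _.
  exact: (measurableT_comp (mg j) (measurable_tnth j)).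
have mhc : measurable_fun [set: mR * n.-tuple mR]
    ((fun t => (\prod_j g j (tnth t j))%:E) \o @tcons R n).
  exact: (measurableT_comp mh (@measurable_tcons R n)).
have fin : \int[lam]_x \int[leb n]_t
    `|(\prod_j g j (tnth (tcons (x, t)) j))%:E| < +oo.
  under eq_integral => x _.
    under eq_integral => t _ do rewrite cE /= normrM EFinM.
    rewrite ge0_integralZl_EFin//.
    over.
  rewrite /= ge0_integralZr//=; last 2 first.
  - by apply/measurable_EFinP; exact: (measurableT_comp (@normr_measurable R setT) (mg ord0)).
  - exact: integral_ge0.
  have /integrableP[_ i1] := ig ord0.
  have /integrableP[_ i2] := iP.
  rewrite lte_mul_pinfty// ?integral_ge0//.
  by rewrite ge0_fin_numE ?integral_ge0.
have ihc : (lam \x leb n).-integrable setT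
    ((fun t => (\prod_j g j (tnth t j))%:E) \o @tcons R n).
  exact/integrable12ltyP.
split.
  apply/integrableP; split=> //; rewrite ge0_integral_leb_cons//.
  exact: (measurableT_comp (@abse_measurable R setT) mh).
rewrite /Rintegral.
have -> : \int[leb n.+1]_t (\prod_j g j (tnth t j))%:E =
    \int[lam \x leb n]_p (\prod_j g j (tnth (tcons p) j))%:E.
  transitivity (\int[pushforward (lam \x leb n) (@tcons R n)]_t
    (\prod_j g j (tnth t j))%:E) => //.
  by rewrite (integral_pushforward (@measurable_tcons R n) mh ihc measurableT).
rewrite -integral12_prod_meas1//=.
rewrite (eq_integral (fun x => (g ord0 x)%:E * \int[leb n]_t (P t)%:E)); last first.
  move=> x _; rewrite /fubini_F; under eq_integral => t _ do rewrite cE EFinM.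
  by rewrite integralZl.
rewrite /= big_ord_recl -IP /Rintegral.
rewrite -[\int[leb n]_t (P t)%:E]fineK; last exact: integrable_fin_num.
rewrite integralZr//; last exact: ig.
by rewrite fineM//; apply: integrable_fin_num => //; exact: ig.
Qed.
End product_integral.

(** * Products of gamma laws *)

Section gamma_tuple.
Context {R : realType}.
Local Notation mR := (measurableTypeR R).
Local Notation lam := (@lebesgue_measure R).
Variable a : R.
Hypothesis a0 : 0 < a.

Let mpos : measurable (`]0, +oo[%classic : set mR).
Proof. exact: measurable_itv. Qed.

Lemma integrable_gamma_fun k :
  lam.-integrable `]0, +oo[%classic (EFin \o gamma_fun a k).
Proof.
apply/integrableP; split.
  apply/measurable_EFinP; apply: measurable_funTS.
  by apply: continuous_measurable_fun; exact: continuous_gamma_fun.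
have := ltry (k`!%:R / a ^+ k.+1); rewrite -integral_gamma_fun//.
congr (_ < _)%E; apply: eq_integral => y; rewrite inE/= in_itv/= andbT => y0.
by rewrite ger0_norm// mulr_ge0 ?expR_ge0 ?exprn_ge0// ltW.
Qed.

(** Horner induction on p, generalised over k: multiplying the polynomial by its
    variable raises the exponent of the gamma density by one, which is
    [gamma_mean_cons] on the algebraic side. *)
Lemma integral_gamma_poly k (p : {poly R}) :
  lam.-integrable `]0, +oo[%classic (EFin \o (fun y => gamma_fun a k y * p.[a * y])) /\
  \int[lam]_(y in `]0, +oo[) (gamma_fun a k y * p.[a * y]) =
    k`!%:R / a ^+ k.+1 * gamma_mean k%:R p.
Proof.
elim/poly_ind: p k => [|p c IH] k.
  rewrite gamma_mean0 mulr0; have E : (fun y => gamma_fun a k y * 0.[a * y]) = cst 0.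
    by apply/funext => y; rewrite horner0 mulr0.
  rewrite E; split; last by rewrite Rintegral_cst// mul0r.
  by apply: (eq_integrable mpos (cst 0%E)) => //; exact: integrable0.
have [i1 I1] := IH k.+1; have i2 := integrable_gamma_fun k.
have E y : gamma_fun a k y * (p * 'X + c%:P).[a * y] =
    a * (gamma_fun a k.+1 y * p.[a * y]) + c * gamma_fun a k y.
  by rewrite hornerD hornerM hornerX hornerC /gamma_fun exprS; ring.
have j1 : lam.-integrable `]0, +oo[%classic
    (EFin \o (fun y => a * (gamma_fun a k.+1 y * p.[a * y]))).
  exact: (integrableZl mpos a i1).
have j2 : lam.-integrable `]0, +oo[%classic (EFin \o (fun y => c * gamma_fun a k y)).
  exact: (integrableZl mpos c i2).
split.
  apply: (eq_integrable mpos _ _ _ (integrableD mpos j1 j2)) => y _ /=.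
  by rewrite E.
under eq_Rintegral do rewrite E.
rewrite RintegralD// !RintegralZl// I1 /Rintegral (integral_gamma_fun a0) /=.
rewrite gamma_mean_cons factS natrM !exprS -natr1.
by field; rewrite !gt_eqF// ?exprn_gt0.
Qed.

Lemma integral_gamma_tuple n (k : 'I_n -> nat) (p : 'I_n -> {poly R}) :
  let h (t : n.-tuple mR) :=
    \prod_j (gamma_fun a (k j) (tnth t j) * (p j).[a * tnth t j]) in
  (leb n).-integrable (@pos_tuple R n) (EFin \o h) /\
  \int[leb n]_(t in @pos_tuple R n) h t =
    \prod_j ((k j)`!%:R / a ^+ (k j).+1 * gamma_mean (k j)%:R (p j)).
Proof.
move=> h; pose g j y := gamma_fun a (k j) y * (p j).[a * y].
pose g' j : mR -> R := (g j) \_ `]0, +oo[%classic.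
have hE : h \_ (@pos_tuple R n) = fun t => \prod_j g' j (tnth t j).
  apply/funext => t; rewrite patchE; case: ifPn => [|].
    rewrite inE => tpos; apply: eq_bigr => j _; rewrite /g' patchE ifT//.
    by rewrite inE /= in_itv/= tpos.
  rewrite notin_setE => /existsNP[j tj].
  rewrite (bigD1 j)//= /g' patchE ifN ?mul0r// notin_setE /= in_itv/= andbT.
  exact: tj.
have ig j : lam.-integrable setT (EFin \o g' j).
  rewrite /g' -restrict_EFin -integrable_mkcond//.
  by have [] := integral_gamma_poly (k j) (p j).
have [i1 I1] := integral_prod_tuple ig; split.
  rewrite integrable_mkcond ?restrict_EFin ?hE//; exact: measurable_pos_tuple.
rewrite Rintegral_mkcond hE I1; apply: eq_bigr => j _.
rewrite /g' -Rintegral_mkcond.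
by have [] := integral_gamma_poly (k j) (p j).
Qed.
End gamma_tuple.

(** * Expectation under a product of gamma laws *)

Section gamma_expectation.
Context {R : realType} (d : nat).
Local Notation mR := (measurableTypeR R).
Local Notation pos := (@pos_tuple R d).
Variables (a : R) (k : 'I_d -> nat).
Hypothesis a0 : 0 < a.
Implicit Types (h g : d.-tuple mR -> R) (p : 'I_d -> {poly R}).

(** The unnormalised density of independent gamma laws with shapes k_j + 1 and rate a. *)
Definition gamma_weight (t : d.-tuple mR) : R :=
  \prod_j gamma_fun a (k j) (tnth t j).

Definition gamma_integrable h : Prop :=
  (leb d).-integrable pos (EFin \o (fun t => gamma_weight t * h t)).

Definition gamma_expect h : R :=
  (\int[leb d]_(t in pos) (gamma_weight t * h t)) /
  (\int[leb d]_(t in pos) gamma_weight t).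

Let mpos : measurable pos. Proof. exact: measurable_pos_tuple. Qed.

Lemma gamma_weight_ge0 t : pos t -> 0 <= gamma_weight t.
Proof.
move=> tpos; apply: prodr_ge0 => j _.
by rewrite mulr_ge0 ?expR_ge0// exprn_ge0// ltW.
Qed.

Lemma measurable_gamma_weight : measurable_fun [set: d.-tuple mR] gamma_weight.
Proof.
apply: measurable_prod => j _; apply: (measurableT_comp _ (measurable_tnth j)).
by apply: continuous_measurable_fun; exact: continuous_gamma_fun.
Qed.

Lemma gamma_weight_poly p t :
  gamma_weight t * \prod_j (p j).[a * tnth t j] =
  \prod_j (gamma_fun a (k j) (tnth t j) * (p j).[a * tnth t j]).
Proof. by rewrite big_split. Qed.

Lemma gamma_weight_total : \int[leb d]_(t in pos) gamma_weight t =
  \prod_j ((k j)`!%:R / a ^+ (k j).+1).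
Proof.
have [_] := integral_gamma_tuple a0 k (fun=> 1).
under eq_Rintegral do under eq_bigr do rewrite hornerC mulr1.
by move=> ->; apply: eq_bigr => j _; rewrite gamma_mean1 mulr1.
Qed.

Lemma gamma_weight_total_gt0 : 0 < \int[leb d]_(t in pos) gamma_weight t.
Proof.
rewrite gamma_weight_total; apply: prodr_gt0 => j _.
by rewrite divr_gt0 ?exprn_gt0// ltr0n fact_gt0.
Qed.

Lemma gamma_integrable_prod p :
  gamma_integrable (fun t => \prod_j (p j).[a * tnth t j]).
Proof.
have [i1 _] := integral_gamma_tuple a0 k p.
by apply: (eq_integrable mpos _ _ _ i1) => t _ /=; rewrite gamma_weight_poly.
Qed.

(** Independence of the coordinates; the normalisation cancels. *)
Lemma gamma_expect_prod p :
  gamma_expect (fun t => \prod_j (p j).[a * tnth t j]) =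
  \prod_j gamma_mean (k j)%:R (p j).
Proof.
have [_ I1] := integral_gamma_tuple a0 k p.
rewrite /gamma_expect; under eq_Rintegral do rewrite gamma_weight_poly.
rewrite I1 big_split -gamma_weight_total mulrAC divff ?mul1r//.
by rewrite gt_eqF// gamma_weight_total_gt0.
Qed.

Lemma gamma_integrableD h g : gamma_integrable h -> gamma_integrable g ->
  gamma_integrable (fun t => h t + g t).
Proof.
move=> ih ig; apply: (eq_integrable mpos _ _ _ (integrableD mpos ih ig)) => t _ /=.
by rewrite mulrDr EFinD.
Qed.

Lemma gamma_integrableZ c h : gamma_integrable h ->
  gamma_integrable (fun t => c * h t).
Proof.
move=> ih; apply: (eq_integrable mpos _ _ _ (integrableZl mpos c ih)) => t _ /=.
by rewrite mulrCA EFinM.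
Qed.

Lemma gamma_expectD h g : gamma_integrable h -> gamma_integrable g ->
  gamma_expect (fun t => h t + g t) = gamma_expect h + gamma_expect g.
Proof.
move=> ih ig; rewrite /gamma_expect -mulrDl -RintegralD//.
by under eq_Rintegral do rewrite mulrDr.
Qed.

Lemma gamma_expectZ c h : gamma_integrable h ->
  gamma_expect (fun t => c * h t) = c * gamma_expect h.
Proof.
move=> ih; rewrite /gamma_expect mulrA -RintegralZl//.
by under eq_Rintegral do rewrite mulrCA.
Qed.

Lemma gamma_expect_sum (I : Type) (r : seq I) (h : I -> d.-tuple mR -> R) :
  (forall i, gamma_integrable (h i)) ->
  gamma_integrable (fun t => \sum_(i <- r) h i t) /\
  gamma_expect (fun t => \sum_(i <- r) h i t) = \sum_(i <- r) gamma_expect (h i).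
Proof.
move=> ih; elim: r => [|i r [IH1 IH2]].
  have E : (fun t => \sum_(i <- [::]) h i t) = fun t => 0 * \prod_j (1 : {poly R}).[a * tnth t j].
    by apply/funext => t; rewrite big_nil mul0r.
  have ip := gamma_integrable_prod (fun=> 1).
  rewrite E; split; first exact: gamma_integrableZ.
  by rewrite gamma_expectZ// mul0r big_nil.
have E : (fun t => \sum_(j <- i :: r) h j t) = fun t => h i t + \sum_(j <- r) h j t.
  by apply/funext => t; rewrite big_cons.
rewrite E big_cons -IH2; split; first exact: gamma_integrableD.
exact: gamma_expectD.
Qed.

Lemma ler_norm_gamma_expect h g : gamma_integrable h -> gamma_integrable g ->
  (forall t, pos t -> `|h t| <= g t) -> `|gamma_expect h| <= gamma_expect g.
Proof.
move=> ih ig hg; have Z0 := gamma_weight_total_gt0.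
rewrite /gamma_expect normrM normfV [X in _ / X]gtr0_norm// ler_pM2r ?invr_gt0//.
rewrite (le_trans (le_normr_Rintegral _ ih))//; apply: le_Rintegral => //.
  exact: (integrable_abse ih).
move=> t tpos; rewrite normrM ger0_norm ?gamma_weight_ge0// ler_wpM2l ?hg//.
exact: gamma_weight_ge0.
Qed.

Lemma gamma_integrable_bounded h (B : R) : measurable_fun [set: d.-tuple mR] h ->
  (forall t, `|h t| <= B) -> gamma_integrable h.
Proof.
move=> mh hB; have i1 := gamma_integrableZ B (gamma_integrable_prod (fun=> 1)).
have mW := measurable_gamma_weight.
apply: (le_integrable mpos _ _ i1) => [|t tpos /=].
  by apply/measurable_EFinP; apply: measurable_funTS; exact: measurable_funM.
rewrite lee_fin !normrM ler_wpM2l// big1 ?normr1 ?mulr1.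
  by rewrite (le_trans (hB t))// ler_norm.
by move=> j _; rewrite hornerC.
Qed.

End gamma_expectation.

(** * The two integrals as gamma expectations *)

Section integral_identities.
Context {R : realType} (d : nat).
Local Notation mR := (measurableTypeR R).
Local Notation pos := (@pos_tuple R d).
Local Notation Cd := 'rV[R[i]^o]_d.
Variables (N : nat) (k : 'I_d -> nat).
Hypothesis N0 : (0 < N)%N.
Let kz : 'rV[int]_d := \row_j (k j)%:Z.
Let a : R := N%:R.
Let a0 : 0 < a. Proof. by rewrite ltr0n. Qed.

Lemma sum_expR (I : Type) (r : seq I) (F : I -> R) :
  expR (\sum_(i <- r) F i) = \prod_(i <- r) expR (F i).
Proof. exact: (big_morph _ (@expRD R) (@expR0 R)). Qed.

(** N (x_j log y_j - y_j) = k_j log y_j - N y_j at x = k / N. *)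
Lemma mellin_weightE t : pos t ->
  mellin_weight N (N%:R^-1 *: real_point kz) (vec_of_tuple t) = gamma_weight a k t.
Proof.
move=> tpos; rewrite /mellin_weight mulr_sumr sum_expR; apply: eq_bigr => j _.
rewrite !mxE /= mulrBr expRD mulrA mulrA divff ?gt_eqF// mul1r.
by rewrite -pmulrn expRM_natl lnK// posrE tpos.
Qed.

Lemma twisted_mellinE f :
  twisted_mellin N f (N%:R^-1 *: real_point kz) =
  gamma_expect a k (fun t => f (vec_of_tuple t)).
Proof.
rewrite /twisted_mellin /gamma_expect /integral_Rd.
have -> : (@vec_of_tuple R d) @^-1` (@positive_orthant R d) = pos.
  by apply/seteqP; split => t h j; have := h j; rewrite ?mxE//= ?mxE.
by congr (_ / _); apply: eq_Rintegral => t /set_mem tpos; rewrite mellin_weightE.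
Qed.

Lemma tnth_sqr_moduli (u : (d + d).-tuple mR) j :
  tnth (sqr_moduli u) j = normc (cvec_of_tuple u 0 j) ^+ 2.
Proof. by rewrite !tnth_mktuple mxE normc_sqr. Qed.

Lemma normcX (z : R[i]) n : normc (z ^+ n) = normc z ^+ n.
Proof. by elim: n => [|n IH]; rewrite ?expr0 ?normc1// !exprS normcM IH. Qed.

(** The Gaussian weight depends on z only through the |z_j|^2, at which it is the
    gamma density. *)
Lemma gauss_weightE (u : (d + d).-tuple mR) : gauss_weight N kz (cvec_of_tuple u) =
  gamma_weight a k (sqr_moduli u).
Proof.
rewrite /gauss_weight /gamma_weight /gamma_fun big_split /=; congr (_ * _).
  rewrite /monomial (big_morph _ (@normcM R) (@normc1 R)) -prodrXl.
  apply: eq_bigr => j _; rewrite tnth_sqr_moduli mxE.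
  have -> : kz 0 j = (k j)%:Z by rewrite mxE.
  by rewrite -exprnP normcX -!exprM mulnC.
rewrite mulr_sumr -sumrN sum_expR; apply: eq_bigr => j _.
by rewrite tnth_sqr_moduli.
Qed.

Lemma lift_moduliE f (u : (d + d).-tuple mR) :
  lift_moduli f (cvec_of_tuple u) = f (vec_of_tuple (sqr_moduli u)).
Proof.
by congr f; apply/rowP => j; rewrite [LHS]mxE [RHS]mxE tnth_sqr_moduli.
Qed.

(** The numerator and [cNk ^+ 2] carry the same polar constant, which cancels. *)
Lemma normalized_integralE f : continuous f ->
  normalized_integral N kz (lift_moduli f) =
  gamma_expect a k (fun t => f (vec_of_tuple t)).
Proof.
move=> cf; have [c c0 HC] := @Rintegral_sqr_moduli R d.
have mf := continuous_measurable_tuple cf.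
have mW := measurable_gamma_weight a k.
have I1 : integral_Cd (gauss_weight N kz : Cd -> R) =
    c * \int[leb d]_(t in pos) gamma_weight a k t.
  rewrite -HC//; apply: eq_Rintegral => u _; exact: gauss_weightE.
have I2 : integral_Cd (fun z : Cd => gauss_weight N kz z * lift_moduli f z) =
    c * \int[leb d]_(t in pos) (gamma_weight a k t * f (vec_of_tuple t)).
  rewrite -HC; last exact: measurable_funM.
  by apply: eq_Rintegral => u _; rewrite gauss_weightE lift_moduliE.
have Z0 := gamma_weight_total_gt0 k a0.
rewrite /normalized_integral /cNk sqr_sqrtr I1 ?mulr_ge0 ?ltW// I2 /gamma_expect.
by rewrite invfM mulrACA mulVf ?gt_eqF// mul1r mulrC.
Qed.

End integral_identities.

(** * Taylor's formula in one variable *)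

Section taylor1.
Context {R : realType}.

Lemma is_derive_taylor_term (c x t : R) (i : nat) :
  is_derive t 1 (fun t : R => c * (t - x) ^+ i / i`!%:R)
    (if i is i'.+1 then c * (t - x) ^+ i' / i'`!%:R else 0).
Proof.
case: i => [|i].
  rewrite (_ : (fun t => _) = cst (c * 1 / 0`!%:R)); first exact: is_derive_cst.
  by apply/funext => u; rewrite expr0.
have h1 : is_derive t 1 (fun u : R => u - x) 1.
  by apply: is_derive_eq; rewrite subr0.
have h2 := @is_derive1_comp _ _ (fun u => u - x) t _ _ (is_derive_exprn i.+1 (t - x)) h1.
rewrite (_ : (fun t => _) = c / (i.+1)`!%:R \*:
    ((fun y : R => y ^+ i.+1) \o (fun u => u - x))); last first.
  by apply/funext => u; rewrite /= /GRing.scale /= mulrAC.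
apply: is_derive_eq; rewrite /GRing.scale /= mulr1 factS natrM.
have : i`!%:R != 0 :> R by rewrite pnatr_eq0 -lt0n fact_gt0.
have : i.+1%:R != 0 :> R by rewrite pnatr_eq0.
move: (i.+1%:R : R) (i`!%:R : R) => a b a0 b0.
by field; rewrite a0 b0.
Qed.

(** Mean value inequality on the segment between x and y, in either order. *)
Lemma mvt_bound (g dg : R -> R) (x y C : R) :
  (forall t : R, is_derive t 1 g (dg t)) -> g x = 0 ->
  (forall t, `|t - x| <= `|y - x| -> `|dg t| <= C) ->
  `|g y| <= C * `|y - x|.
Proof.
move=> dg' gx0 gC.
have cg (t : R) : {for t, continuous g}.
  apply: differentiable_continuous; apply/derivable1_diffP.
  by have [] := dg' t.
have [xy|yx|xy] := ltgtP x y; last by rewrite -xy gx0 subrr !normr0 mulr0.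
- have [|c /itvP cxy] := MVT xy (fun t _ => dg' t).
    exact/continuous_subspaceT.
  rewrite gx0 subr0 => ->; rewrite normrM ler_wpM2r// gC//.
  by rewrite !ger0_norm ?subr_ge0 ?lerD2r ?cxy// ltW.
- have [|c /itvP cyx] := MVT yx (fun t _ => dg' t).
    exact/continuous_subspaceT.
  rewrite gx0 sub0r => /eqP; rewrite eqr_oppLR => /eqP ->.
  rewrite normrN normrM (distrC x) ler_wpM2r// gC//.
  by rewrite !ler0_norm ?subr_le0 ?lerN2 ?lerD2r ?cyx// ltW.
Qed.

(** Taylor's formula without the factor 1 / M! in the remainder, which allows a
    direct induction: the error for [F] vanishes at x and its derivative is the error
    for [F \o S], so [mvt_bound] gains one power of |y - x|.  The sequence [F] plays the
    role of the successive derivatives. *)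
Lemma taylor1 (M : nat) (F : nat -> R -> R) (x y C : R) :
  (forall i (t : R), is_derive t 1 (F i) (F i.+1 t)) ->
  (forall t, `|t - x| <= `|y - x| -> `|F M t| <= C) ->
  `|F 0%N y - \sum_(i < M) F i x * (y - x) ^+ i / i`!%:R| <= C * `|y - x| ^+ M.
Proof.
elim: M F y => [|M IH] F y dF FC.
  by rewrite big_ord0 subr0 expr0 mulr1 FC.
rewrite exprSr mulrA.
apply: (@mvt_bound (fun t => F 0%N t - \sum_(i < M.+1) F i x * (t - x) ^+ i / i`!%:R)
   (fun t => F 1%N t - \sum_(i < M) F i.+1 x * (t - x) ^+ i / i`!%:R)).
- move=> t; apply: is_deriveB.
  rewrite (_ : (fun t => _) =
    \sum_(i < M.+1) (fun t => F i x * (t - x) ^+ i / i`!%:R)); last first.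
    by apply/funext => u; rewrite fct_sumE.
  apply: is_derive_eq.
    by apply: is_derive_sum => i; exact: is_derive_taylor_term.
  by rewrite big_ord_recl /= add0r; apply: eq_bigr => i _; rewrite /bump leq0n.
- rewrite big_ord_recl subrr expr0 mulr1 divr1 big1 ?addr0 ?subrr// => i _.
  by rewrite expr0n /= mulr0 mul0r.
- move=> t tx; apply: (@le_trans _ _ (C * `|t - x| ^+ M)).
    by apply: (IH (fun i => F i.+1)) => // u ux; exact/FC/(le_trans ux).
  have C0 : 0 <= C by apply: le_trans (FC x _); rewrite ?subrr ?normr0.
  by rewrite ler_wpM2l// lerXn2r// nnegrE.
Qed.
End taylor1.

(** * Taylor's formula in several variables *)

Section coordinate_lines.
Context {R : realType} (d : nat).
Implicit Types (f h : 'rV[R]_d -> R) (x y : 'rV[R]_d).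

Definition set_coord y (j : 'I_d) (t : R) : 'rV[R]_d :=
  \row_i (if i == j then t else y 0 i).

Lemma set_coordD y j (t u : R) :
  set_coord y j (u + t) = u *: delta_mx 0 j + set_coord y j t.
Proof.
by apply/rowP => i; rewrite !mxE eqxx /=; case: eqP => _; rewrite ?mulr1// mulr0 add0r.
Qed.

(** Moving along a coordinate line is moving in the direction of a basis vector. *)
Lemma is_derive_coord h y j (t : R) :
  derivable h (set_coord y j t) (delta_mx 0 j) ->
  is_derive t 1 (fun t : R => h (set_coord y j t)) (partial j h (set_coord y j t)).
Proof.
move=> dh; rewrite /partial.
have E : (fun u : R => u^-1 *: (h (set_coord y j (u *: 1 + t)) - h (set_coord y j t))) =
  (fun u : R => u^-1 *: (h (u *: delta_mx 0 j + set_coord y j t) - h (set_coord y j t))).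
  by apply/funext => u; rewrite [u *: 1]mulr1 set_coordD.
by split; rewrite /derivable /derive /= /shift /= ?E.
Qed.

Lemma smooth_partial f j : smooth f -> smooth (partial j f).
Proof.
move=> sf s; have := sf (rcons s j).
by rewrite /partials foldr_rcons.
Qed.

Lemma smooth_iter f j n : smooth f -> smooth (iter n (partial j) f).
Proof. by elim: n => //= n IH sf; exact/smooth_partial/IH. Qed.

Lemma smooth_continuous f : smooth f -> continuous f.
Proof. by move=> /(_ [::])[]. Qed.

Lemma smooth_derivable f x j : smooth f -> derivable f x (delta_mx 0 j).
Proof. by move=> /(_ [::])[_]. Qed.

Lemma continuous_box_bounded f (a b : R) : continuous f -> exists2 C : R, 0 <= C &
  forall x, (forall j, a <= x 0 j <= b) -> `|f x| <= C.
Proof.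
move=> cf; have K : compact [set x : 'rV[R]_d | forall j, `[a, b]%classic (x ord0 j)].
  exact: (@rV_compact R d (fun=> `[a, b]%classic) (fun=> @segment_compact R a b)).
have /compact_bounded [C [_ HC]] : compact (f @`
    [set x : 'rV[R]_d | forall j, `[a, b]%classic (x ord0 j)]).
  by apply: continuous_compact => //; exact: continuous_subspaceT.
exists (`|C| + 1) => [|x xab]; first by rewrite addr_ge0.
apply: HC; first by rewrite (le_lt_trans (ler_norm C))// ltrDl.
by exists x => //= j; rewrite in_itv/=.
Qed.

Lemma taylor_coord h j y (c : R) (M : nat) (C : R) : smooth h ->
  (forall t, `|t - c| <= `|y 0 j - c| ->
     `|iter M (partial j) h (set_coord y j t)| <= C) ->
  `|h y - \sum_(i < M) iter i (partial j) h (set_coord y j c) *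
     (y 0 j - c) ^+ i / i`!%:R| <= C * `|y 0 j - c| ^+ M.
Proof.
move=> sh hC; have yE : set_coord y j (y 0 j) = y.
  by apply/rowP => i; rewrite mxE; case: eqP => // ->.
have := @taylor1 _ M (fun i t => iter i (partial j) h (set_coord y j t)) c (y 0 j) C.
rewrite yE; apply=> // i t; apply: is_derive_coord.
exact/smooth_derivable/smooth_iter.
Qed.

End coordinate_lines.

Section multi_index.
Variables (I : finType) (m : nat).
Implicit Types (s : seq I) (alpha : {ffun I -> 'I_m.+1}).

Definition update_at alpha j a : {ffun I -> 'I_m.+1} :=
  [ffun i => if i == j then a else alpha i].

Definition supported s alpha := [forall i, (i \in s) || (alpha i == ord0)].

Lemma sum_supported_cons (V : nmodType) s j (G : {ffun I -> 'I_m.+1} -> V) :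
  j \notin s ->
  \sum_(alpha | supported (j :: s) alpha) G alpha =
  \sum_(alpha | supported s alpha) \sum_a G (update_at alpha j a).
Proof.
move=> js; rewrite pair_big_dep /=.
rewrite (reindex_onto (fun p : {ffun I -> 'I_m.+1} * 'I_m.+1 => update_at p.1 j p.2)
   (fun alpha => (update_at alpha j ord0, alpha j))) /=; last first.
  by move=> alpha _; apply/ffunP => i; rewrite !ffunE; case: eqP => // ->.
apply: eq_bigl => -[alpha a] /=.
have -> : update_at alpha j a j = a by rewrite ffunE eqxx.
rewrite xpair_eqE eqxx !andbT.
apply/andP/forallP => [[/forallP h /eqP e] i|h].
  have := h i; rewrite in_cons -e !ffunE; case: eqP => [->|//].
  by rewrite eqxx orbT.
have aj : alpha j = ord0 by have := h j; rewrite (negbTE js) => /eqP.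
split.
  by apply/forallP => i; rewrite in_cons ffunE; case: eqP => //= _; exact: h.
by apply/eqP/ffunP => i; rewrite !ffunE; case: eqP => // ->.
Qed.

End multi_index.

Section taylor_cube.
Context {R : realType} (d m : nat).
Implicit Types (f h : 'rV[R]_d -> R) (x y : 'rV[R]_d).
Local Notation multi := {ffun 'I_d -> 'I_m.+1}.

Definition partial_along (s : seq 'I_d) (alpha : 'I_d -> nat) f :=
  foldr (fun j => iter (alpha j) (partial j)) f s.

(** The point with coordinates from x on s and from y elsewhere. *)
Definition mix (s : seq 'I_d) x y : 'rV[R]_d :=
  \row_i (if i \in s then x 0 i else y 0 i).

Definition taylor_term (s : seq 'I_d) (alpha : multi) f x y : R :=
  partial_along s (fun j => alpha j) f (mix s x y) *
  \prod_(j <- s) ((y 0 j - x 0 j) ^+ alpha j / (alpha j)`!%:R).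

Lemma smooth_partial_along s alpha f : smooth f -> smooth (partial_along s alpha f).
Proof. by move=> sf; elim: s => //= j s IH; exact: smooth_iter. Qed.

Lemma partial_along_update_at s (alpha : multi) j a f : j \notin s ->
  partial_along s (fun i => update_at alpha j a i) f = partial_along s (fun i => alpha i) f.
Proof.
elim: s => //= i s IH; rewrite in_cons negb_or => /andP[ji js].
by rewrite IH// ffunE eq_sym (negbTE ji).
Qed.

(** Taylor expansion in the coordinates listed in s, the last one first: in this
    order the derivatives appear nested as in [multi_partial].  In the step each term already obtained is
    expanded in one more coordinate by [taylor_coord]; the new remainder is controlled
    by the maximum of finitely many derivatives on a compact cube, and the monomials
    already present are at most 1 because |y_j - x_j| <= 1. *)
Lemma taylor_along (s : seq 'I_d) f (K : R) : uniq s -> smooth f ->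
  exists2 C : R, 0 <= C & forall x y,
  (forall j, 0 <= x 0 j <= K) -> (forall j, `|y 0 j - x 0 j| <= 1) ->
  `|f y - \sum_(alpha : multi | supported s alpha) taylor_term s alpha f x y| <=
  C * \sum_(j <- s) `|y 0 j - x 0 j| ^+ m.+1.
Proof.
move=> + sf; elim: s => [|j s IH] /=.
  move=> _; exists 0 => // x y xK yx.
  rewrite mul0r (big_pred1 [ffun=> ord0]); last first.
    move=> alpha /=; apply/forallP/eqP => [h|-> i]; last by rewrite ffunE eqxx orbT.
    by apply/ffunP => i; rewrite ffunE; have := h i => /= /eqP.
  rewrite /taylor_term /= big_nil mulr1 (_ : mix _ _ _ = y) ?subrr ?normr0//.
  by apply/rowP => i; rewrite mxE.
move=> /andP[js us]; have [C C0 HC] := IH us.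
have bnd (alpha : multi) : exists2 D : R, 0 <= D & forall z : 'rV[R]_d,
    (forall i, - 1 <= z 0 i <= K + 1) ->
    `|iter m.+1 (partial j) (partial_along s (fun j => alpha j) f) z| <= D.
  apply: continuous_box_bounded; apply/smooth_continuous/smooth_iter.
  exact: smooth_partial_along.
pose D alpha := sval (cid2 (bnd alpha)).
have D0 alpha : 0 <= D alpha by rewrite /D; case: cid2.
have DP (alpha : multi) : forall z : 'rV[R]_d, (forall i, - 1 <= z 0 i <= K + 1) ->
    `|iter m.+1 (partial j) (partial_along s (fun j => alpha j) f) z| <= D alpha.
  by rewrite /D; case: cid2.
pose E := \sum_alpha D alpha; have E0 : 0 <= E by exact: sumr_ge0.
exists (C + E) => [|x y xK yx]; first exact: addr_ge0.
rewrite sum_supported_cons//.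
set S1 := \sum_(alpha | supported s alpha) taylor_term s alpha f x y in HC *.
set S2 := \sum_(alpha | _) _.
rewrite (_ : f y - S2 = (f y - S1) + (S1 - S2)); last by rewrite addrA subrK.
rewrite (le_trans (ler_normD _ _))// big_cons mulrDr [leRHS]addrC lerD//.
  by rewrite (le_trans (HC x y xK yx))// ler_wpM2r ?sumr_ge0// lerDl.
apply: (@le_trans _ _ (E * `|y 0 j - x 0 j| ^+ m.+1)); last first.
  by rewrite ler_wpM2r// lerDr.
rewrite /S1 /S2 -sumrB (le_trans (ler_norm_sum _ _ _))//.
rewrite /E mulr_suml [leRHS](bigID (supported s)) /=.
rewrite -[leLHS]addr0 lerD//; last by apply: sumr_ge0 => *; rewrite mulr_ge0.
apply: ler_sum => alpha salpha.
set P := \prod_(j <- s) ((y 0 j - x 0 j) ^+ alpha j / (alpha j)`!%:R).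
set h := partial_along s (fun j => alpha j) f.
have -> : taylor_term s alpha f x y - \sum_a taylor_term (j :: s) (update_at alpha j a) f x y =
  (h (mix s x y) - \sum_(a < m.+1) iter a (partial j) h (set_coord (mix s x y) j (x 0 j)) *
     (mix s x y 0 j - x 0 j) ^+ a / a`!%:R) * P.
  rewrite mulrBl mulr_suml; congr (_ - _); apply: eq_bigr => a _.
  rewrite /taylor_term /= partial_along_update_at// ffunE eqxx big_cons ffunE eqxx.
  rewrite [X in _ * (_ * X)](_ : _ = P); last first.
    rewrite /P !big_seq; apply: eq_bigr => i si; rewrite ffunE ifF//.
    by apply/eqP => ij; rewrite ij (negbTE js) in si.
  rewrite !mulrA (_ : mix (j :: s) x y = set_coord (mix s x y) j (x 0 j)); last first.
    by apply/rowP => i; rewrite !mxE in_cons; case: eqP => // ->.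
  by rewrite !mxE (negbTE js).
have P1 : `|P| <= 1.
  suff /andP[] : 0 <= `|P| <= 1 by [].
  rewrite /P; apply: (big_ind (fun z : R => 0 <= `|z| <= 1)) => [|u v|i _].
  - by rewrite normr1 ler01 lexx.
  - by move=> /andP[_ u1] /andP[_ v1]; rewrite normr_ge0 normrM mulr_ile1.
  rewrite normr_ge0 normrM normrX normfV normr_nat mulr_ile1 ?invr_ge0//=.
    by rewrite exprn_ile1.
  by rewrite invf_le1 ?ltr0n ?fact_gt0// ler1n fact_gt0.
rewrite normrM -[leRHS]mulr1 ler_pM//.
have -> : y 0 j = mix s x y 0 j by rewrite mxE (negbTE js).
apply: taylor_coord; first exact: smooth_partial_along.
move=> t; rewrite mxE (negbTE js) => tx; apply: DP => i; rewrite !mxE.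
have tx1 : `|t - x 0 j| <= 1 := le_trans tx (yx j).
have /andP[x0 x1] := xK i; have := yx i; rewrite ler_norml => /andP[y0 y1].
move: tx1; rewrite ler_norml => /andP[t0 t1].
case: eqP => [ij|_]; first by move: x0 x1; rewrite ij => *; apply/andP; split; lra.
by case: ifP => _; apply/andP; split; lra.
Qed.

End taylor_cube.

Section taylor_global.
Context {R : realType} (d m : nat).
Implicit Types (f : 'rV[R]_d -> R) (x y : 'rV[R]_d).
Local Notation multi := {ffun 'I_d -> 'I_m.+1}.

(** All multi-indices with entries at most m, not only those of total degree at
    most m: this is what the coordinatewise expansion produces. *)
Definition taylor_cube f x y : R := \sum_(alpha : multi)
  multi_partial (fun j => alpha j) f x *
  \prod_j ((y 0 j - x 0 j) ^+ alpha j / (alpha j)`!%:R).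

Lemma taylor_cubeE f x y : taylor_cube f x y =
  \sum_(alpha : multi | supported (enum 'I_d) alpha)
    taylor_term (enum 'I_d) alpha f x y.
Proof.
apply: eq_big => [alpha|alpha _].
  by apply/esym/forallP => i; rewrite mem_enum.
rewrite /taylor_term big_enum /= (_ : mix _ x y = x) //.
by apply/rowP => i; rewrite mxE mem_enum.
Qed.

Lemma multi_partial_bounded f (alpha : 'I_d -> nat) (K : R) : smooth f ->
  exists2 D : R, 0 <= D & forall x, (forall j, 0 <= x 0 j <= K) ->
    `|multi_partial alpha f x| <= D.
Proof.
move=> sf; apply: continuous_box_bounded; apply: smooth_continuous.
exact: (smooth_partial_along (enum 'I_d) alpha sf).
Qed.

(** Close to x this is [taylor_along].  If some |y_j - x_j| exceeds 1, let v be the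
    largest of them: f is bounded and each term of the Taylor polynomial is at most a
    constant times v^(d m), so the power d (m + 1) of v absorbs both. *)
Lemma taylor_global f (B K : R) : smooth f -> (forall y, `|f y| <= B) ->
  exists2 C : R, 0 <= C & forall x y, (forall j, 0 <= x 0 j <= K) ->
  `|f y - taylor_cube f x y| <=
  C * \sum_j (`|y 0 j - x 0 j| ^+ m.+1 + `|y 0 j - x 0 j| ^+ (d * m.+1)).
Proof.
move=> sf fB.
have [C C0 HC] := @taylor_along R d m (enum 'I_d) f K (enum_uniq _) sf.
have bnd (alpha : multi) := @multi_partial_bounded f (fun j => alpha j) K sf.
pose D alpha := sval (cid2 (bnd alpha)).
have D0 alpha : 0 <= D alpha by rewrite /D; case: cid2.
have DP (alpha : multi) : forall x : 'rV[R]_d, (forall i, 0 <= x 0 i <= K) ->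
    `|multi_partial (fun j => alpha j) f x| <= D alpha.
  by rewrite /D; case: cid2.
pose E := \sum_alpha D alpha; have E0 : 0 <= E by exact: sumr_ge0.
exists (C + (`|B| + E)) => [|x y xK]; first by rewrite !addr_ge0.
pose u (j : 'I_d) : R := `|y 0 j - x 0 j|.
set S := \sum_j _; have S0 : 0 <= S.
  by apply: sumr_ge0 => j _; rewrite addr_ge0// exprn_ge0.
have [/forallP near|/forallPn[j0]] := boolP [forall j, u j <= 1].
  rewrite mulrDl -[leLHS]addr0 lerD ?mulr_ge0 ?addr_ge0//.
  rewrite taylor_cubeE (le_trans (HC x y xK near))// ler_wpM2l// big_enum /=.
  by apply: ler_sum => j _; rewrite lerDl exprn_ge0.
rewrite -ltNge => u1; rewrite mulrDl -[leLHS]add0r lerD ?mulr_ge0//.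
case: (@arg_maxP _ _ _ j0 xpredT u) => // jm _ umax.
pose v : R := u jm; have {}umax j : u j <= v by exact: umax.
have v1 : 1 < v by rewrite (lt_le_trans u1)// umax.
have v0 : 0 <= v by rewrite normr_ge0.
have vE : 1 <= v ^+ (d * m.+1) by rewrite exprn_ege1// ltW.
apply: (@le_trans _ _ ((`|B| + E) * v ^+ (d * m.+1))); last first.
  rewrite ler_wpM2l ?addr_ge0// /S (bigD1 jm)//= -[leLHS]addr0 lerD//.
    by rewrite lerDr exprn_ge0.
  by apply: sumr_ge0 => j _; rewrite addr_ge0// exprn_ge0.
rewrite (le_trans (ler_normB _ _))// mulrDl lerD//.
  by rewrite (le_trans (fB y))// (le_trans (ler_norm B))// ler_peMr.
rewrite (le_trans (ler_norm_sum _ _ _))// /E mulr_suml.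
apply: ler_sum => alpha _; rewrite normrM ler_pM// ?DP// normr_prod.
have -> : v ^+ (d * m.+1) = \prod_(j < d) v ^+ m.+1.
  by rewrite prodr_const card_ord mulnC exprM.
apply: ler_prod => j _.
rewrite normr_ge0 normrM normfV normrX normr_nat /=.
rewrite -[leRHS]mulr1 ler_pM ?exprn_ge0 ?invr_ge0//.
  apply: (@le_trans _ _ (v ^+ alpha j)).
    by rewrite lerXn2r ?nnegrE//; exact: umax.
  by rewrite ler_weXn2l ?(ltW v1)// ltnW.
by rewrite invf_le1 ?ltr0n ?fact_gt0// ler1n fact_gt0.
Qed.
End taylor_global.

(** * Asymptotic estimates *)

Section asymptotics.
Context {R : realType} (d : nat).
Local Notation mR := (measurableTypeR R).
Implicit Types (f : 'rV[R]_d -> R) (N : nat) (k : 'I_d -> nat).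

Definition lattice_row k : 'rV[int]_d := \row_j (k j)%:Z.

(** The natural size of Y_j - k_j / N under the gamma law of rate N. *)
Definition inv_sqrt N : R := (Num.sqrt N%:R)^-1.

Lemma inv_sqrt_gt0 N : (0 < N)%N -> 0 < inv_sqrt N.
Proof. by move=> N0; rewrite invr_gt0 sqrtr_gt0 ltr0n. Qed.

Lemma inv_sqrt_le1 N : (0 < N)%N -> inv_sqrt N <= 1.
Proof.
move=> N0; rewrite invf_le1 ?sqrtr_gt0 ?ltr0n// -[leLHS]sqrtr1 ler_wsqrtr//.
by rewrite ler1n.
Qed.

Lemma inv_sqrt2 N : inv_sqrt N ^+ 2 = N%:R^-1.
Proof. by rewrite /inv_sqrt exprVn sqr_sqrtr. Qed.

Lemma powR_inv_sqrt N n : (N%:R : R) `^ (- (n%:R / 2)) = inv_sqrt N ^+ n.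
Proof.
rewrite powRN mulrC powRrM powR12_sqrt// powR_mulrn ?sqrtr_ge0//.
by rewrite /inv_sqrt exprVn.
Qed.

(** Boundedness of the polytope gives k_j = O(N), which makes the estimates uniform
    in k; membership also forces the entries of k to be nonnegative. *)
Lemma lattice_point_polytope (Delta : set 'rV[R]_d) (K : R) N (k : 'rV[int]_d) :
  (0 < N)%N -> (forall x, Delta x -> forall j, 0 <= x 0 j <= K) ->
  lattice_point Delta N k ->
  exists2 k' : 'I_d -> nat, k = lattice_row k' &
    forall j, (k' j)%:R <= K * N%:R :> R.
Proof.
move=> N0 HK [x Dx xk]; have N0' : 0 < N%:R :> R by rewrite ltr0n.
have kE j : (k 0 j)%:~R = N%:R * x 0 j :> R.
  by have /rowP/(_ j) := xk; rewrite !mxE.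
have k0 j : 0 <= k 0 j.
  rewrite -(ler0z R) kE pmulr_rge0//; by have /andP[] := HK x Dx j.
exists (fun j => absz (k 0 j)); first by apply/rowP => j; rewrite mxE gez0_abs.
move=> j; rewrite pmulrn gez0_abs// kE mulrC.
by rewrite ler_pM2r//; have /andP[] := HK x Dx j.
Qed.

(** The moment is O((K N)^(n / 2)) by [gamma_moment_bound], with n / 2 rounded down,
    against the prefactor N^(- n). *)
Lemma scaled_moment_bound (K : R) n : 0 <= K -> exists2 C : R, 0 <= C &
  forall N i, (0 < N)%N -> i%:R <= K * N%:R :> R ->
  0 <= N%:R ^- n * gamma_moment n (i%:R : R) <= C * inv_sqrt N ^+ n.
Proof.
move=> K0; have [C C0 HC] := @gamma_moment_bound R n.
exists (C * (K + 1) ^+ n./2) => [|N i N0 iK].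
  by rewrite mulr_ge0 ?exprn_ge0 ?addr_ge0.
have /andP[m0 m1] := HC i%:R (ler0n _ _).
have N0' : 0 < N%:R :> R by rewrite ltr0n.
rewrite mulr_ge0 ?invr_ge0 ?exprn_ge0 ?(ltW N0')//=.
have i1 : i%:R + 1 <= (K + 1) * N%:R :> R by rewrite mulrDl mul1r lerD// ler1n.
apply: (@le_trans _ _ (N%:R ^- n * (C * ((K + 1) * N%:R) ^+ n./2))).
  rewrite ler_wpM2l ?invr_ge0 ?exprn_ge0 ?(ltW N0')// (le_trans m1)//.
  by rewrite ler_wpM2l// lerXn2r// nnegrE ?addr_ge0// mulr_ge0 ?addr_ge0// ltW.
have s0 := inv_sqrt_gt0 N0; have s1 := inv_sqrt_le1 N0.
rewrite exprMn mulrCA -[leRHS]mulrA ler_wpM2l// mulrCA ler_wpM2l ?exprn_ge0 ?addr_ge0//.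
rewrite -exprVn -inv_sqrt2 -exprM.
have -> : N%:R ^+ n./2 = (inv_sqrt N ^+ 2) ^- n./2 by rewrite inv_sqrt2 exprVn invrK.
rewrite -exprM ler_pdivrMr ?exprn_gt0// -exprD.
apply: ler_wiXn2l; rewrite ?(ltW s0)//.
by have := odd_double_half n; rewrite -muln2; lia.
Qed.

Lemma prodrX_sum (I : finType) (x : R) (n : I -> nat) :
  \prod_j x ^+ n j = x ^+ (\sum_j n j)%N.
Proof. by rewrite (big_morph _ (exprD x) (expr0 x)). Qed.

(** The factor g_m(k_j) is the centered moment divided by m!. *)
Lemma expansion_termE f N k (alpha : 'I_d -> nat) :
  expansion_term f N (lattice_row k) alpha =
  multi_partial alpha f (N%:R^-1 *: real_point (lattice_row k)) *
  \prod_j (N%:R ^- alpha j / (alpha j)`!%:R * gamma_moment (alpha j) (k j)%:R).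
Proof.
rewrite /expansion_term mulrAC mulrC; congr (_ * _).
rewrite -exprVn -prodrX_sum -big_split; apply: eq_bigr => j _ /=.
by rewrite !mxE gamma_momentE exprVn -mulrA mulKf// pnatr_eq0 -lt0n fact_gt0.
Qed.

Lemma lattice_row_box N k (K : R) : (0 < N)%N -> (forall j, (k j)%:R <= K * N%:R) ->
  forall j, 0 <= (N%:R^-1 *: real_point (lattice_row k) : 'rV[R]_d) 0 j <= K.
Proof.
move=> N0 kK j; rewrite !mxE mulr_ge0 ?invr_ge0//= mulrC.
by rewrite ler_pdivrMr ?ltr0n// kK.
Qed.

Lemma expansion_term_bound f (K : R) (alpha : 'I_d -> nat) : 0 <= K -> smooth f ->
  exists2 C : R, 0 <= C & forall N k, (0 < N)%N ->
  (forall j, (k j)%:R <= K * N%:R) ->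
  `|expansion_term f N (lattice_row k) alpha| <= C * inv_sqrt N ^+ (\sum_j alpha j)%N.
Proof.
move=> K0 sf; have [D D0 HD] := multi_partial_bounded alpha K sf.
have bnd n := scaled_moment_bound n K0.
pose C n := sval (cid2 (bnd n)).
have C0 n : 0 <= C n by rewrite /C; case: cid2.
have CP n : forall N i, (0 < N)%N -> i%:R <= K * N%:R :> R ->
    0 <= N%:R ^- n * gamma_moment n (i%:R : R) <= C n * inv_sqrt N ^+ n.
  by rewrite /C; case: cid2.
exists (D * \prod_j C (alpha j)) => [|N k N0 kK].
  by rewrite mulr_ge0// prodr_ge0.
rewrite expansion_termE normrM -mulrA ler_pM ?HD//.
  exact: lattice_row_box.
rewrite -prodrX_sum -big_split normr_prod; apply: ler_prod => j _ /=.
have /andP[m0 m1] := CP (alpha j) N (k j) N0 (kK j).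
rewrite normr_ge0 mulrAC normrM ger0_norm//= normfV normr_nat.
rewrite (le_trans _ m1)// ler_piMr// invf_le1 ?ltr0n ?fact_gt0//.
by rewrite ler1n fact_gt0.
Qed.

Section fixed_lattice_point.
Variables (N : nat) (k : 'I_d -> nat).
Hypothesis N0 : (0 < N)%N.
Let a : R := N%:R.
Let a0 : 0 < a. Proof. by rewrite ltr0n. Qed.
Let x : 'rV[R]_d := N%:R^-1 *: real_point (lattice_row k).

(** The polynomial whose value at N t is (t - k_j / N)^n. *)
Definition centered_poly j n : {poly R} := N%:R ^- n *: ('X - (k j)%:R%:P) ^+ n.

Lemma centered_polyE j n (t : R) :
  (centered_poly j n).[a * t] = (t - x 0 j) ^+ n.
Proof.
rewrite hornerZ horner_exp hornerXsubC -exprVn -exprMn !mxE; congr (_ ^+ _).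
by rewrite mulrBr mulrA mulVf ?gt_eqF// mul1r.
Qed.

Lemma gamma_mean_centered j n :
  gamma_mean (k j)%:R (centered_poly j n) = N%:R ^- n * gamma_moment n (k j)%:R.
Proof. by rewrite gamma_meanZ. Qed.

(** The expectation of the Taylor polynomial at k / N is the asymptotic series, term
    by term: this is where the functions g_alpha come from. *)
Lemma gamma_expect_taylor_cube m f :
  gamma_integrable a k (fun t => taylor_cube m f x (vec_of_tuple t)) /\
  gamma_expect a k (fun t => taylor_cube m f x (vec_of_tuple t)) =
  \sum_(alpha : {ffun 'I_d -> 'I_m.+1})
    expansion_term f N (lattice_row k) (fun j => alpha j).
Proof.
pose p (alpha : {ffun 'I_d -> 'I_m.+1}) j :=
  ((alpha j)`!%:R)^-1 *: centered_poly j (alpha j).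
pose h (alpha : {ffun 'I_d -> 'I_m.+1}) (t : d.-tuple mR) :=
  multi_partial (fun j => alpha j) f x * \prod_j (p alpha j).[a * tnth t j].
have ip alpha := gamma_integrable_prod k a0 (p alpha).
have ih alpha : gamma_integrable a k (h alpha) by exact: gamma_integrableZ.
have E : (fun t => taylor_cube m f x (vec_of_tuple t)) = fun t => \sum_alpha h alpha t.
  apply/funext => t; apply: eq_bigr => alpha _; congr (_ * _).
  apply: eq_bigr => j _; rewrite hornerZ centered_polyE mulrC.
  by rewrite [vec_of_tuple t 0 j]mxE.
rewrite E; have [i1 ->] := gamma_expect_sum a0 (index_enum _) ih; split => //.
apply: eq_bigr => alpha _; rewrite gamma_expectZ// gamma_expect_prod// expansion_termE.
congr (_ * _); apply: eq_bigr => j _.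
by rewrite gamma_meanZ gamma_mean_centered mulrCA mulrA.
Qed.

Lemma gamma_expect_centered j n :
  gamma_integrable a k (fun t => (tnth t j - x 0 j) ^+ n) /\
  gamma_expect a k (fun t => (tnth t j - x 0 j) ^+ n) =
  N%:R ^- n * gamma_moment n (k j)%:R.
Proof.
pose p i := if i == j then centered_poly j n else 1.
have E : (fun t : d.-tuple mR => (tnth t j - x 0 j) ^+ n) =
    fun t => \prod_i (p i).[a * tnth t i].
  apply/funext => t; rewrite (bigD1 j)//= /p eqxx centered_polyE big1 ?mulr1// => i ij.
  by rewrite (negbTE ij) hornerC.
rewrite E; split; first exact: gamma_integrable_prod.
rewrite gamma_expect_prod// (bigD1 j)//= /p eqxx gamma_mean_centered big1 ?mulr1// => i ij.
by rewrite (negbTE ij) gamma_mean1.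
Qed.

(** By the inequality b <= c + b^2 / c with c = N^(- q / 2), a polynomial in t that
    dominates |t_j - x_j|^q: absolute moments of odd order are thus reduced to
    even moments, which are explicit. *)
Definition power_majorant q j (t : d.-tuple mR) : R :=
  inv_sqrt N ^+ q + inv_sqrt N ^- q * (tnth t j - x 0 j) ^+ (2 * q).

Lemma norm_le_power_majorant q j t : `|tnth t j - x 0 j| ^+ q <= power_majorant q j t.
Proof.
set b := `|_| ^+ q; have -> : power_majorant q j t = inv_sqrt N ^+ q + inv_sqrt N ^- q * b ^+ 2.
  by rewrite /power_majorant /b exprM [in RHS]exprAC real_normK ?num_real.
have b0 : 0 <= b by rewrite exprn_ge0.
have c0 : 0 < inv_sqrt N ^+ q by rewrite exprn_gt0// inv_sqrt_gt0.
have [bc|/ltW cb] := leP b (inv_sqrt N ^+ q).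
  by rewrite (le_trans bc)// lerDl mulr_ge0 ?sqr_ge0// invr_ge0 ltW.
rewrite -[leLHS]add0r lerD ?(ltW c0)// mulrC ler_pdivlMr//.
by rewrite expr2 ler_wpM2l.
Qed.

Lemma gamma_expect_power_majorant q j :
  gamma_integrable a k (power_majorant q j) /\
  gamma_expect a k (power_majorant q j) =
  inv_sqrt N ^+ q + inv_sqrt N ^- q * (N%:R ^- (2 * q) * gamma_moment (2 * q) (k j)%:R).
Proof.
have [i1 E1] := gamma_expect_centered j (2 * q).
have i0 := gamma_integrable_prod k a0 (fun=> 1).
have E : power_majorant q j = fun t => inv_sqrt N ^+ q * \prod_i (1 : {poly R}).[a * tnth t i] +
    inv_sqrt N ^- q * (tnth t j - x 0 j) ^+ (2 * q).
  by apply/funext => t; rewrite big1 ?mulr1// => i _; rewrite hornerC.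
have j0 := gamma_integrableZ (inv_sqrt N ^+ q) i0.
have j1 := gamma_integrableZ (inv_sqrt N ^- q) i1.
rewrite E; split; first exact: gamma_integrableD.
rewrite gamma_expectD// !gamma_expectZ// E1 gamma_expect_prod//.
by rewrite big1 ?mulr1// => i _; exact: gamma_mean1.
Qed.

End fixed_lattice_point.

(** The expectation of the remainder in [taylor_global].  The contribution of the
    exponent d (m + 1) is O(N^(- d (m + 1) / 2)), hence O(N^(- (m + 1) / 2)), since a
    sum over j : 'I_d is empty when d = 0. *)
Lemma taylor_expect_bound f (B K : R) m : 0 <= K -> smooth f ->
  (forall y, `|f y| <= B) ->
  exists2 C : R, 0 <= C & forall N k, (0 < N)%N ->
  (forall j, (k j)%:R <= K * N%:R) ->
  `|gamma_expect N%:R k (fun t => f (vec_of_tuple t)) -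
    \sum_(alpha : {ffun 'I_d -> 'I_m.+1})
      expansion_term f N (lattice_row k) (fun j => alpha j)| <=
  C * inv_sqrt N ^+ m.+1.
Proof.
move=> K0 sf fB; have [C C0 HC] := taylor_global m K sf fB.
have [D1 D10 HD1] := scaled_moment_bound (2 * m.+1) K0.
have [D2 D20 HD2] := scaled_moment_bound (2 * (d * m.+1)) K0.
exists (C * (d%:R * ((1 + D1) + (1 + D2)))) => [|N k N0 kK].
  by rewrite !mulr_ge0 ?addr_ge0.
pose x : 'rV[R]_d := N%:R^-1 *: real_point (lattice_row k).
have xK : forall j, 0 <= x 0 j <= K by exact: lattice_row_box.
have s0 := inv_sqrt_gt0 N0; have s1 := inv_sqrt_le1 N0.
have a0 : 0 < N%:R :> R by rewrite ltr0n.
have [iT <-] := gamma_expect_taylor_cube k N0 m f.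
have if' : gamma_integrable N%:R k (fun t => f (vec_of_tuple t)).
  apply: (@gamma_integrable_bounded _ _ _ _ a0 _ B) => //.
  by apply: continuous_measurable_tuple; exact: smooth_continuous.
have iNT := gamma_integrableZ (-1) iT.
have E : gamma_expect N%:R k (fun t => f (vec_of_tuple t)) -
    gamma_expect N%:R k (fun t => taylor_cube m f x (vec_of_tuple t)) =
  gamma_expect N%:R k (fun t => f (vec_of_tuple t) +
    -1 * taylor_cube m f x (vec_of_tuple t)).
  by rewrite gamma_expectD// gamma_expectZ// mulN1r.
rewrite E.
pose g j t := power_majorant N k m.+1 j t + power_majorant N k (d * m.+1) j t.
have ig j : gamma_integrable N%:R k (g j).
  by apply: gamma_integrableD; apply: (gamma_expect_power_majorant _ _ _ _).1.
have [iS ES] := gamma_expect_sum a0 (index_enum 'I_d) ig.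
have iCS := gamma_integrableZ C iS.
apply: (le_trans (ler_norm_gamma_expect a0 (gamma_integrableD if' iNT) iCS _)).
  move=> t tpos; rewrite mulN1r (le_trans (HC x _ xK))// ler_wpM2l//.
  apply: ler_sum => j _; rewrite mxE.
  by apply: lerD; exact: norm_le_power_majorant.
rewrite gamma_expectZ// ES -!mulrA ler_wpM2l//.
have -> : d%:R * ((1 + D1 + (1 + D2)) * inv_sqrt N ^+ m.+1) =
    \sum_(j < d) ((1 + D1) * inv_sqrt N ^+ m.+1 + (1 + D2) * inv_sqrt N ^+ m.+1).
  by rewrite sumr_const card_ord -mulrDl mulr_natl.
apply: ler_sum => j _.
have [i1 E1] := gamma_expect_power_majorant k N0 m.+1 j.
have [i2 E2] := gamma_expect_power_majorant k N0 (d * m.+1) j.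
have aux q D : 0 <= N%:R ^- (2 * q) * gamma_moment (2 * q) ((k j)%:R : R) <= D * inv_sqrt N ^+ (2 * q) ->
    inv_sqrt N ^+ q + inv_sqrt N ^- q * (N%:R ^- (2 * q) * gamma_moment (2 * q) (k j)%:R) <=
    (1 + D) * inv_sqrt N ^+ q.
  move=> /andP[_ h]; rewrite mulrDl mul1r lerD2l ler_pdivrMl ?exprn_gt0//.
  by rewrite mulrCA -exprD addnn -mul2n.
rewrite /g gamma_expectD// E1 E2 lerD//; first by apply/aux/HD1.
apply: le_trans (aux _ _ (HD2 _ _ N0 (kK j))) _.
rewrite ler_wpM2l ?addr_ge0// ler_wiXn2l ?(ltW s0)//.
by rewrite leq_pmull// (leq_trans _ (ltn_ord j)).
Qed.

End asymptotics.

(** * The expansion *)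

Theorem mainTheorem1 (R : realType) (d : nat) (G : set 'rV[R[i]^o]_d)
    (g : {vspace 'rV[R]_d}) (lambda : 'Hom(subvs_of g, R^o))
    (f : 'rV[R]_d -> R) :
  is_subtorus G -> is_lie_algebra G g ->
  weight_lattice lambda -> compact_toric_reduction G lambda ->
  smooth f -> (exists B : R, forall x, `|f x| <= B) ->
  [/\ forall (N : nat) (k : 'rV[int]_d), (0 < N)%N ->
        lattice_point (polytope lambda) N k ->
        normalized_integral N k (lift_moduli f) =
        twisted_mellin N f (N%:R^-1 *: real_point k),
      forall alpha : 'I_d -> nat, exists C : R,
        forall (N : nat) (k : 'rV[int]_d), (0 < N)%N ->
        lattice_point (polytope lambda) N k ->
        `|expansion_term f N k alpha| <=
        C * N%:R `^ (- ((\sum_j alpha j)%N%:R / 2)) &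
      forall M : nat, (1 <= M)%N -> exists C : R,
        forall (N : nat) (k : 'rV[int]_d), (0 < N)%N ->
        lattice_point (polytope lambda) N k ->
        `|normalized_integral N k (lift_moduli f) - expansion_sum f N k M| <=
        C * N%:R `^ (- (M%:R / 2))].
Proof.
move=> [Gtorus [G1 _] _ _] _ _ [_ cQ] sf [B fB].
have [K0 HK0] := polytope_bounded Gtorus G1 cQ.
pose K := `|K0|; have K_ge0 : 0 <= K by exact: normr_ge0.
have HK x : polytope lambda x -> forall j, 0 <= x 0 j <= K.
  by move=> /HK0 xK j; have /andP[-> /le_trans->] := xK j; rewrite ?ler_norm.
have cf := smooth_continuous sf.
split.
- move=> N _ N0 /(lattice_point_polytope N0 HK)[k -> _].
  by rewrite normalized_integralE// twisted_mellinE.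
- move=> alpha; have [C _ HC] := expansion_term_bound alpha K_ge0 sf.
  exists C => N _ N0 /(lattice_point_polytope N0 HK)[k -> kK].
  by rewrite powR_inv_sqrt; exact: HC.
case=> // m _; pose multi := {ffun 'I_d -> 'I_m.+1}.
have [C _ HC] := taylor_expect_bound m K_ge0 sf fB.
have bnd (alpha : multi) :=
  expansion_term_bound (fun j => alpha j) K_ge0 sf.
pose D (alpha : multi) := sval (cid2 (bnd alpha)).
have D0 alpha : 0 <= D alpha by rewrite /D; case: cid2.
have DP (alpha : multi) : forall N k, (0 < N)%N ->
    (forall j, (k j)%:R <= K * N%:R) ->
    `|expansion_term f N (lattice_row k) (fun j => alpha j)| <=
    D alpha * inv_sqrt N ^+ (\sum_j alpha j)%N.
  by rewrite /D; case: cid2.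
exists (C + \sum_alpha D alpha) => N _ N0 /(lattice_point_polytope N0 HK)[k -> kK].
rewrite powR_inv_sqrt normalized_integralE//.
have := HC N k N0 kK; set E := gamma_expect _ _ _.
set T := \sum_alpha _ => ET.
(* T runs over the whole box alpha_j <= m; its terms with |alpha| > m are of order
   N^(-M/2) and join the remainder. *)
have -> : expansion_sum f N (lattice_row k) m.+1 =
    T - \sum_(alpha : multi | ~~ (\sum_j alpha j < m.+1)%N)
      expansion_term f N (lattice_row k) (fun j => alpha j).
  by rewrite /T (bigID (fun alpha : multi => (\sum_j alpha j < m.+1)%N)) /= addrK.
rewrite opprB addrA addrAC mulrDl (le_trans (ler_normD _ _))// lerD//.
rewrite (le_trans (ler_norm_sum _ _ _))// mulr_suml.
rewrite [leRHS](bigID (fun alpha : multi => ~~ (\sum_j alpha j < m.+1)%N)) /=.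
have s0 := @inv_sqrt_gt0 R N N0; have s1 := @inv_sqrt_le1 R N N0.
rewrite -[leLHS]addr0 lerD//; last first.
  by apply: sumr_ge0 => alpha _; rewrite mulr_ge0// exprn_ge0// ltW.
apply: ler_sum => alpha; rewrite -leqNgt => Malpha.
rewrite (le_trans (DP alpha N k N0 kK))// ler_wpM2l//.
by rewrite ler_wiXn2l// ltW.
Qed.
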